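(* Consider the piecewise smooth slow-fast Liénard system $$\begin{cases}\dot x=y-F_-(x),\\ \dot y=\epsilon G_-(x),\end{cases}\ x\le 0,\qquad \begin{cases}\dot x=y-F_+(x),\\ \dot y=\epsilon G_+(x),\end{cases}\ x\ge 0,$$ where $0<\epsilon\ll1$, $F_\pm,G_\pm$ are $C^\infty$-smooth and $F_\pm(0)=F_\pm'(0)=G_\pm(0)=0$, $F_\pm''(0)>0$, $G_\pm'(0)<0$. Let $\hat y>0$ and let $\alpha(\hat y)<0<\omega(\hat y)$ satisfy $F_-(\alpha(\hat y))=\hat y=F_+(\omega(\hat y))$, with $$F_-'(x)<0,\ G_-(x)>0\ \ \forall x\in[\alpha(\hat y),0[,\qquad F_+'(x)>0,\ G_+(x)<0\ \ \forall x\in\,]0,\omega(\hat y)].$$ Let $I=I_+-I_-$ be the difference of the slow divergence integrals and assume that the canard cycle $\Gamma_{\hat y}$ is balanced, i.e. $I(\hat y)=0$. Let $H$ be the slow relation function defined near $\hat y$. Suppose that $y^*>0$ is small and $I$ is nonzero on $]\hat y,\hat y+y^*[$. Let $m_{\hat y}(I)\in\{1,2,\dots\}\cup\{\infty\}$ be the multiplicity of the zero $y=\hat y$ of $I$ and, if it is finite, let $i_{m_{\hat y}(I)}\neq0$ be the $m_{\hat y}(I)$-th Taylor coefficient of $I$ about $y=\hat y$. If $y_0\in\,]\hat y,\hat y+y^*[$, then the following statements are true. 1. Suppose $1\le m_{\hat y}(I)<\infty$. If $i_{m_{\hat y}(I)}>0$ (resp. $<0$), then the orbit $U=\{y_l\mid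 l\in\mathbb N\}$ of $y_0$ by $H$ (resp. $H^{-1}$) tends monotonically to $\hat y$ and the following bijective correspondence holds: $$m_{\hat y}(I)=\frac{1}{1-\dim_BU}.$$ Moreover, if $1<m_{\hat y}(I)<\infty$, then $U$ is Minkowski nondegenerate. 2. If $m_{\hat y}(I)=\infty$, then $\dim_BU=1$, where $U$ is the orbit of $y_0$ by $H$ if $I>0$ on $]\hat y,\hat y+y^*[$ and by $H^{-1}$ if $I<0$ on $]\hat y,\hat y+y^*[$. These results do not depend on the choice of the initial point $y_0\in\,]\hat y,\hat y+y^*[$.
   Context: Canard cycle: $\Gamma_{\hat y}$ consists of the horizontal segment of $\{y=\hat y\}$ between $(\alpha(\hat y),\hat y)$ and $(\omega(\hat y),\hat y)$ together with the part of the curve of singularities $\{(x,F_-(x)):x\le0\}\cup\{(x,F_+(x)):x\ge0\}$ between these two points. Slow divergence integrals: for $y$ near $\hat y$ let $\alpha(y)<0<\omega(y)$ be the smooth continuations of $\alpha(\hat y),\omega(\hat y)$ with $F_-(\alpha(y))=y=F_+(\omega(y))$, and $$I_-(y)=-\int_{\alpha(y)}^{0}\frac{F_-'(x)^2}{G_-(x)}\,dx<0,\qquad I_+(y)=-\int_{\omega(y)}^{0}\frac{F_+'(x)^2}{G_+(x)}\,dx<0,\qquad I(y)=I_+(y)-I_-(y).$$ One has $I_\pm'(y)<0$. The slow relation function $H$ is the smooth function near $\hat y$ with $H(\hat y)=\hat y$ and $I_-(H(y))=I_+(y)$. The orbit of $y_0$ by $H$ is given by $I_-(y_{l+1})=I_+(y_l)$,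 $l\ge0$, and the orbit by $H^{-1}$ by $I_-(y_l)=I_+(y_{l+1})$, $l\ge0$. The number $y^*$ is taken small enough that everything is defined. Minkowski dimension: for bounded $U\subset\mathbb R$ let $|U_\delta|$ be the Lebesgue measure of the closed $\delta$-neighborhood $U_\delta=\{x:\mathrm{dist}(x,U)\le\delta\}$. For $s\ge0$ put $\mathcal M_*^s(U)=\liminf_{\delta\to0}|U_\delta|/\delta^{1-s}$ and $\mathcal M^{*s}(U)=\limsup_{\delta\to0}|U_\delta|/\delta^{1-s}$; $\underline\dim_BU=\inf\{s\ge0:\mathcal M_*^s(U)=0\}$, $\overline\dim_BU=\inf\{s\ge0:\mathcal M^{*s}(U)=0\}$. If they coincide, the common value is $\dim_BU$. $U$ is Minkowski nondegenerate if there is $d$ with $0<\mathcal M_*^d(U)\le\mathcal M^{*d}(U)<\infty$ (then $d=\dim_BU$). *)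

(* Defs.v *)
From HB Require Import structures.
From mathcomp Require Import all_boot all_order all_algebra.
From mathcomp Require Import all_classical all_reals all_analysis.
Import Order.TTheory GRing.Theory Num.Theory.
Import numFieldNormedType.Exports.

Set Implicit Arguments.
Unset Strict Implicit.
Unset Printing Implicit Defensive.

Local Open Scope ring_scope.
Local Open Scope classical_set_scope.

Section Smoothness.
Context {R : realType}.
Implicit Types (f : R -> R) (a : R) (m : nat).

Definition smooth f := forall n x, derivable (derive1n n f) x 1.

(* The neighborhood of [a] is the same for all orders of differentiation. *)
Definition smooth_near f a :=
  \forall x \near a, forall n, derivable (derive1n n f) x 1.

Definition taylor_coef f a m : R := derive1n m f a / m`!%:R.

Definition zero_multiplicity f a m :=
  (forall k, (k < m)%N -> taylor_coef f a k = 0) /\ taylor_coef f a m != 0.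

Definition zero_multiplicity_infinite f a := forall k, taylor_coef f a k = 0.

End Smoothness.

Section SlowDivergence.
Context {R : realType}.
Implicit Types (F G : R -> R).

Definition oriented_integral (a b : R) (f : R -> R) : R :=
  if a <= b then \int[lebesgue_measure]_(x in `[a, b]) f x
  else - \int[lebesgue_measure]_(x in `[b, a]) f x.

(* [c] is alpha or omega. The integrand extends continuously by 0 at [x = 0]
   when both [derive1 F] and [G] have a simple zero there, which agrees with
   the convention [0 / 0 = 0]. *)
Definition slow_divergence F G (c : R -> R) (y : R) : R :=
  - oriented_integral (c y) 0 (fun x => derive1 F x ^+ 2 / G x).

(* All the conditions are local: they determine only the germ of [H]. *)
Definition slow_relation (Im Ip : R -> R) (yhat : R) (H : R -> R) :=
  [/\ smooth_near H yhat, H yhat = yhat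
    & \forall y \near yhat, Im (H y) = Ip y].

Definition local_inverse (H K : R -> R) (a : R) :=
  \forall y \near a, K (H y) = y /\ H (K y) = y.

Definition orbit_seq (f : R -> R) (y0 : R) : R^nat := fun l => iter l f y0.

End SlowDivergence.

Section MinkowskiDimension.
Context {R : realType}.
Implicit Types (U : set R) (s d delta : R).

Definition closed_neighborhood U delta : set R :=
  [set x | (edist_inf U x <= delta%:E)%E].

Definition minkowski_ratio U s delta : \bar R :=
  (lebesgue_measure (closed_neighborhood U delta)
     * ((delta `^ (1 - s))^-1)%:E)%E.

Definition lower_minkowski_content s U : \bar R :=
  limf_einf (minkowski_ratio U s) (0 : R)^'+.

Definition upper_minkowski_content s U : \bar R :=
  limf_esup (minkowski_ratio U s) (0 : R)^'+.

(* The sets below are nonempty for bounded [U], where they contain every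
   [s > 1], so that the real-valued infimum is meaningful. *)
Definition lower_box_dim U : R :=
  inf [set s | 0 <= s /\ lower_minkowski_content s U = 0%E].

Definition upper_box_dim U : R :=
  inf [set s | 0 <= s /\ upper_minkowski_content s U = 0%E].

Definition has_box_dim U d := lower_box_dim U = d /\ upper_box_dim U = d.

Definition minkowski_nondegenerate U :=
  exists2 d, 0 <= d &
    [/\ (0 < lower_minkowski_content d U)%E,
        (lower_minkowski_content d U <= upper_minkowski_content d U)%E
      & (upper_minkowski_content d U < +oo)%E].

End MinkowskiDimension.

(* Main.v *)
Require Import Defs.
From HB Require Import structures.
From mathcomp Require Import all_boot all_order all_algebra.
From mathcomp Require Import all_classical all_reals all_analysis.
Import Order.TTheory GRing.Theory Num.Theory.
Import numFieldNormedType.Exports.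
Local Open Scope ring_scope.
Local Open Scope classical_set_scope.
From mathcomp Require Import ring lra.

(** Up to a bounded nonzero factor, the difference [I] of the slow divergence
    integrals measures the displacement of the slow relation function. Since
    [Im (H y) = Ip y], one has [I y = Im (H y) - Im y], and [Im] has a continuous
    negative derivative near [yhat], so that [I y] lies between two positive
    multiples of [y - H y] when it is positive. The orbit of [y0] by [H], or by its
    inverse when [I] is negative, is therefore a monotone sequence whose limit is
    the only available zero [yhat] of [I], and whose gaps are comparable to [|I|]
    evaluated at one end of the gap ([slow_relation_local], [forward_orbit],
    [backward_orbit]).

    If the multiplicity [m] is finite, Taylor's formula makes [|I y|] comparable to
    [(y - yhat) ^+ m]. This formula applies because the derivative of a slow
    divergence integral is the smooth function [derive1 F (c y) / G (c y)]
    ([slow_divergence_derive]): the integrand [derive1 F x ^+ 2 / G x] extends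
    continuously through its singular point [0].

    It remains to compute the Minkowski contents of a sequence decreasing to [a]
    with gaps of order [(u l - a) ^+ m]. When [delta] is small, the terms
    closer to [a] than about [t = delta `^ m%:R^-1] have gaps smaller than [delta],
    so that the [delta]-neighborhood contains an interval of length comparable to
    [t] ([closed_neighborhood_measure_ge]). If [m > 1], then [(u l - a) ^- (m - 1)]
    grows at least linearly, so that the number of other terms is
    [O(t ^- (m - 1))] and they contribute a length [O(delta * t ^- (m - 1)) = O(t)]
    ([closed_neighborhood_measure_le]). The measure is thus of exact order
    [delta `^ m%:R^-1], which gives dimension [1 - m%:R^-1] together with
    nondegeneracy. If [m = 1], the convergence is geometric and every positive
    exponent may replace [m - 1] in the upper bound, which gives dimension [0]. If
    the multiplicity is infinite, the lower bound holds with every exponent [k]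
    instead of [m], which gives dimension [1]. *)

(** * Taylor bounds at a zero of finite order *)

Section IteratedDifferentiability.
Set Implicit Arguments.
Unset Strict Implicit.
Unset Printing Implicit Defensive.
Context {R : realType}.
Implicit Types (f g h : R -> R) (a x : R).

(** Stopping at a finite order, on a neighborhood that may depend on it, lets the
    closure properties below be proved by induction on the order. *)
Definition ndiff n f a := forall k, (k < n)%N ->
  \forall x \near a, derivable (derive1n k f) x 1.

Lemma ndiffS n f a : ndiff n.+1 f a <->
  (\forall x \near a, derivable f x 1) /\ ndiff n (derive1 f) a.
Proof.
split=> [nf|[f1 nf] [|k] kn]; last 2 first.
- exact: f1.
- by rewrite derive1Sn; exact: nf.
by split=> [|k kn]; [exact: (nf 0%N)|rewrite -derive1Sn; exact: nf].
Qed.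

Lemma ndiff0 f a : ndiff 0 f a. Proof. by move=> k; rewrite ltn0. Qed.

Lemma ndiffW n f a : ndiff n.+1 f a -> ndiff n f a.
Proof. by move=> nf k kn; apply: nf; rewrite ltnS ltnW. Qed.

Lemma near_eq_derive1 f g a : {near a, f =1 g} ->
  {near a, derive1 f =1 derive1 g}.
Proof.
move=> /near_join fg; near=> x; rewrite !derive1E; apply: near_eq_derive.
by near: x.
Unshelve. all: by end_near. Qed.

Lemma near_eq_derive1n k f g a : {near a, f =1 g} ->
  {near a, derive1n k f =1 derive1n k g}.
Proof.
elim: k f g => [//|k IH] f g fg; rewrite !derive1Sn.
by apply: IH; exact: near_eq_derive1.
Qed.

Lemma near_derivable_eq f g a : {near a, f =1 g} ->
  (\forall x \near a, derivable f x 1) -> \forall x \near a, derivable g x 1.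
Proof.
move=> /near_join fg nf; near=> x; apply: (@near_eq_derivable _ _ _ f).
  by near: x.
by near: x.
Unshelve. all: by end_near. Qed.

Lemma ndiff_near_eq n f g a : {near a, f =1 g} -> ndiff n f a -> ndiff n g a.
Proof.
move=> fg nf k kn; apply: near_derivable_eq (nf k kn).
exact: near_eq_derive1n.
Qed.

Lemma ndiff_cst n (c : R) a : ndiff n (fun=> c) a.
Proof.
elim: n c => [|n IH] c; first exact: ndiff0.
 apply/ndiffS; split.
  by near=> x; exact: derivable_cst.
apply: (@ndiff_near_eq _ (fun=> 0)); last exact: IH.
by near=> x; rewrite derive1_cst.
Unshelve. all: by end_near. Qed.

Lemma ndiffD n f g a : ndiff n f a -> ndiff n g a ->
  ndiff n (fun x => f x + g x) a.
Proof.
elim: n f g => [|n IH] f g; first by move=> _ _; exact: ndiff0.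
move=> /(ndiffS n f a).1[f1 nf] /(ndiffS n g a).1[g1 ng]; apply/ndiffS; split.
  by apply: filterS2 f1 g1 => x fx gx; exact: (derivableD fx gx).
apply: (@ndiff_near_eq _ (fun x => derive1 f x + derive1 g x)).
  by apply: filterS2 f1 g1 => x fx gx; rewrite !derive1E (deriveD fx gx).
exact: IH.
Qed.

Lemma ndiffM n f g a : ndiff n f a -> ndiff n g a ->
  ndiff n (fun x => f x * g x) a.
Proof.
elim: n f g => [|n IH] f g; first by move=> _ _; exact: ndiff0.
move=> nf ng; have nf' := ndiffW nf; have ng' := ndiffW ng.
have [f1 df] := (ndiffS n f a).1 nf; have [g1 dg] := (ndiffS n g a).1 ng.
apply/ndiffS; split.
  by apply: filterS2 f1 g1 => x fx gx; exact: (derivableM fx gx).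
apply: (@ndiff_near_eq _ (fun x => f x * derive1 g x + g x * derive1 f x)).
  by apply: filterS2 f1 g1 => x fx gx; rewrite !derive1E (deriveM fx gx).
exact: (ndiffD (IH _ _ nf' dg) (IH _ _ ng' df)).
Qed.

Lemma ndiffN n f a : ndiff n f a -> ndiff n (fun x => - f x) a.
Proof.
move=> nf; apply: (@ndiff_near_eq _ (fun x => (- 1) * f x)).
  by near=> x; rewrite mulN1r.
exact: (ndiffM (@ndiff_cst n (- 1) a) nf).
Unshelve. all: by end_near. Qed.

Lemma ndiffV n f a : {for a, continuous f} -> f a != 0 -> ndiff n f a ->
  ndiff n (fun x => (f x)^-1) a.
Proof.
move=> cf fa; have f0 : \forall x \near a, f x != 0.
  exact: (cvgr_neq0 (f a) cf fa).
elim: n => [|n IH] nf; first exact: ndiff0.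
have nf' := ndiffW nf; have [f1 df] := (ndiffS n f a).1 nf.
apply/ndiffS; split.
  by apply: filterS2 f0 f1 => x fx0 fx; exact: (derivableV fx0 fx).
apply: (@ndiff_near_eq _ (fun x => - (((f x)^-1 * (f x)^-1) * derive1 f x))).
  apply: filterS2 f0 f1 => x fx0 fx.
  rewrite !derive1E (deriveV fx0 fx) -[LHS]mulNr; congr (_ * _).
  by rewrite -expr2 exprVn.
have iv := IH nf'; exact: (ndiffN (ndiffM (ndiffM iv iv) df)).
Qed.

Lemma derivable_continuous f x : derivable f x 1 -> {for x, continuous f}.
Proof. by move=> /derivable1_diffP/differentiable_continuous. Qed.

Lemma ndiff_smooth_comp n f g a : smooth f -> ndiff n g a ->
  ndiff n (fun x => f (g x)) a.
Proof.
elim: n f => [|n IH] f sf ng; first exact: ndiff0.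
have ng' := ndiffW ng; have [g1 dg] := (ndiffS n g a).1 ng.
have f1 : forall x, derivable f x 1 := sf 0%N.
have sf' : smooth (derive1 f) by move=> k x; rewrite -derive1Sn; exact: sf.
apply/ndiffS; split.
  apply: filterS g1 => x gx.
  have dgx : is_derive x 1 g (derive1 g x) by rewrite derive1E; exact: derivableP.
  have dfx : is_derive (g x) 1 f (derive1 f (g x)).
    by rewrite derive1E; apply: derivableP; exact: f1.
  by have := is_derive1_comp dfx dgx => -[].
apply: (@ndiff_near_eq _ (fun x => derive1 f (g x) * derive1 g x)).
  by apply: filterS g1 => x gx; rewrite -(derive1_comp gx (f1 _)).
exact: (ndiffM (IH _ sf' ng') dg).
Qed.

Lemma ndiff_smooth_near n f a : smooth_near f a -> ndiff n f a.
Proof. by move=> sf k _; apply: filterS sf. Qed.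

Lemma at_right_itvP a (P : set R) : (\forall x \near a^'+, P x) <->
  exists2 e, 0 < e & forall x, a < x < a + e -> P x.
Proof.
split.
  rewrite near_withinE => /nbhs_ballP[e /= e0 eP]; exists e => // x /andP[ax xe].
  by apply: eP => //; rewrite /ball/= ltr0_norm ?subr_lt0//; lra.
move=> [e e0 eP]; near=> x; apply: eP; apply/andP; split; near: x.
  exact: nbhs_right_gt.
by apply: nbhs_right_lt; rewrite ltrDl.
Unshelve. all: by end_near. Qed.

Lemma near_itvP a (P : set R) : (\forall x \near a, P x) <->
  exists2 e, 0 < e & forall x, a - e < x < a + e -> P x.
Proof.
split.
  move=> /nbhs_ballP[e /= e0 eP]; exists e => // x /andP[ax xe].
  by apply: eP => //; rewrite /ball/= ltr_distlC; apply/andP; split; lra.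
move=> [e e0 eP]; apply/nbhs_ballP; exists e => //= x.
by rewrite /ball/= ltr_distlC => /andP[? ?]; apply: eP; apply/andP; split; lra.
Qed.

(** By continuity the [m]-th derivative exceeds [c] near [a]; the bound follows
    by integrating [m] times from [a], where the lower derivatives vanish. *)
Lemma taylor_lower_bound m f a c : ndiff m.+1 f a ->
  (forall k, (k < m)%N -> derive1n k f a = 0) -> c < derive1n m f a ->
  \forall x \near a^'+, c / m`!%:R * (x - a) ^+ m <= f x.
Proof.
elim: m f => [|m IH] f nf f0 cf.
  have cfa : {for a, continuous f}.
    by apply: derivable_continuous; exact: nbhs_singleton (nf 0%N isT).
  apply: cvg_within; apply: filterS (cvgr_gt (f a) cfa _ cf) => x /ltW.
  by rewrite expr0 mulr1 fact0 divr1.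
have [/near_itvP[e e0 fe] df] := (ndiffS m.+1 f a).1 nf.
have := IH (derive1 f) df; rewrite -derive1Sn => /(_ _ cf) {}IH.
have /at_right_itvP[e' e'0 f'e] : \forall x \near a^'+,
    c / m`!%:R * (x - a) ^+ m <= derive1 f x.
  by apply: IH => k km; rewrite -derive1Sn; exact: f0.
apply/at_right_itvP; exists (Num.min e e'); first by rewrite lt_min e0.
move=> x; rewrite -ltrBlDl lt_min !ltrBlDl => /and3P[ax xe xe'].
(* Minorant and function agree at [a], and [h] is their difference. *)
pose h y := f y - c / m.+1`!%:R * (y - a) ^+ m.+1.
have dh y : a - e < y < a + e ->
    is_derive y 1 h (derive1 f y - c / m`!%:R * (y - a) ^+ m).
  move=> ye; have fy : is_derive y 1 f (derive1 f y).
    by rewrite derive1E; apply: derivableP; exact: fe.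
  have dq : is_derive y (1:R) (fun z : R => z - a) (1:R).
    by apply: is_derive_eq; rewrite subr0.
  have dX := @is_deriveX _ _ (fun z : R => z - a) m.+1 y 1 1 dq.
  have dZ := @is_deriveZ _ _ _ _ (c / m.+1`!%:R) _ _ _ dX.
  have -> : h = f - (c / m.+1`!%:R) \*: (fun z : R => z - a) ^+ m.+1.
    by apply/funext => z; rewrite /h !fctE.
  apply: (is_derive_eq (is_deriveB fy dZ)); congr (_ - _).
  rewrite /GRing.scale/= mulr1 factS natrM; field.
  by rewrite nat1r !pnatr_eq0 -!lt0n fact_gt0.
have ch : {within `[a, x], continuous h}.
  apply: derivable_within_continuous => y; rewrite in_itv/= => /andP[ay yx].
  by have [] := dh y _; [apply/andP; split; lra|].
have fa0 : f a = 0 := f0 0%N isT.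
suff : h a <= h x by rewrite /h subrr expr0n mulr0 subr0 fa0 subr_ge0.
apply: (ger0_derive1_le_cc (a := a) (b := x)) => //; last 3 first.
- by rewrite in_itv/= lexx ltW.
- by rewrite in_itv/= lexx ltW.
- exact: ltW.
- move=> y; rewrite in_itv/= => /andP[ay yx].
  by have [] := dh y _; [apply/andP; split; lra|].
move=> y; rewrite in_itv/= => /andP[ay yx].
have [|_] := dh y _; first by apply/andP; split; lra.
rewrite -derive1E => ->; rewrite subr_ge0; apply: f'e.
by apply/andP; split; lra.
Qed.

Lemma taylor_upper_bound m f a c : ndiff m.+1 f a ->
  (forall k, (k < m)%N -> derive1n k f a = 0) -> derive1n m f a < c ->
  \forall x \near a^'+, f x <= c / m`!%:R * (x - a) ^+ m.
Proof.
move=> nf f0 fc.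
have dN k : (k <= m)%N -> derive1n k (fun x => - f x) a = - derive1n k f a.
  move=> km; suff : \forall x \near a,
      derive1n k (fun x => - f x) x = - derive1n k f x.
    exact: nbhs_singleton.
  elim: k km => [_|k IH km]; first by apply: filterE.
  have nfk : \forall x \near a, derivable (derive1n k f) x 1.
    by apply: nf; rewrite ltnS ltnW.
  rewrite !derive1nS; have := near_eq_derive1 (IH (ltnW km)).
  apply: filterS2 nfk => x fx ->.
  by rewrite !derive1E deriveN.
have : \forall x \near a^'+, - c / m`!%:R * (x - a) ^+ m <= - f x.
  apply: taylor_lower_bound; first exact: ndiffN.
    by move=> k km; rewrite dN ?(ltnW km)// f0 ?oppr0.
  by rewrite dN// ltrN2.
by apply: filterS => x; rewrite !mulNr lerN2.
Qed.
End IteratedDifferentiability.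

(** * Slow divergence integrals *)

Section SlowDivergenceIntegral.
Set Implicit Arguments.
Unset Strict Implicit.
Unset Printing Implicit Defensive.
Context {R : realType}.
Implicit Types (f F G c P : R -> R) (a b x y : R).

Lemma cvg_quotient_derive1 f : derivable f 0 1 -> f 0 = 0 ->
  x^-1 * f x @[x --> 0^'] --> derive1 f 0.
Proof.
move=> df f0; have fE : (fun x : R => x^-1 * f x) =
    (fun x : R => x^-1 *: ((f \o shift 0) (x *: 1) - f 0)).
  by apply/funext => x; rewrite /= addr0 f0 subr0 /GRing.scale/= mulr1.
rewrite derive1E fE; exact: df.
Qed.

(** Writing the quotient as [x * ((F x / x) ^+ 2 / (G x / x))], which is also
    correct at [x = 0] because division by zero yields zero, shows that it tends
    to [0 = F 0 ^+ 2 / G 0]. *)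
Lemma continuous_at_simple_zeros F G : derivable F 0 1 -> derivable G 0 1 ->
  F 0 = 0 -> G 0 = 0 -> derive1 G 0 != 0 ->
  {for 0, continuous (fun x => F x ^+ 2 / G x)}.
Proof.
move=> dF dG F0 G0 G'0.
pose f x := F x ^+ 2 / G x.
have fE : f = fun x => x * ((x^-1 * F x) ^+ 2 * (x^-1 * G x)^-1).
  apply/funext => x; rewrite /f; have [->|x0] := eqVneq x 0.
    by rewrite F0 expr0n/= !mul0r.
  have [->|Gx] := eqVneq (G x) 0; first by rewrite mulr0 invr0 !mulr0.
  by field; rewrite x0 Gx.
have lim0 : f x @[x --> 0^'] --> 0 * ((derive1 F 0) ^+ 2 * (derive1 G 0)^-1).
  rewrite fE; apply: cvgM; first exact: nbhs_dnbhs.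
  apply: cvgM.
    by apply: cvgM; exact: cvg_quotient_derive1.
  by apply: cvgV; [exact: G'0|exact: cvg_quotient_derive1].
apply/continuous_withinNx.
rewrite mul0r in lim0.
by rewrite F0 expr0n mul0r.
Qed.

Lemma is_derive_primitive f a b : a < b ->
  (forall x, a <= x <= b -> {for x, continuous f}) ->
  exists P, forall x, a < x < b -> is_derive x 1 P (f x).
Proof.
move=> ab cf; exists (fun x => \int[lebesgue_measure]_(t in `[a, x]) f t).
move=> x /andP[ax xb].
have cfab : {within `[a, b], continuous f}.
  by apply: continuous_in_subspaceT => y; rewrite inE/= in_itv; exact: cf.
have intf : lebesgue_measure.-integrable `[a, b] (EFin \o f).
  by apply: continuous_compact_integrable => //; exact: segment_compact.
have [|dP P'] := continuous_FTC1_closed xb intf ax.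
  by apply: cf; rewrite !ltW.
by apply: DeriveDef; [exact: dP|rewrite -derive1E].
Qed.

Lemma oriented_integralE f P a b x y :
  (forall z, a < z < b -> {for z, continuous f}) ->
  (forall z, a < z < b -> is_derive z 1 P (f z)) ->
  a < x < b -> a < y < b -> oriented_integral x y f = P y - P x.
Proof.
move=> cf dP; rewrite /oriented_integral.
have le_case u v : u < v -> a < u < b -> a < v < b ->
    \int[lebesgue_measure]_(z in `[u, v]) f z = P v - P u.
  move=> uv /andP[au ub] /andP[av vb].
  have uvab z : u <= z <= v -> a < z < b.
    by move=> /andP[uz zv]; apply/andP; split; lra.
  rewrite /Rintegral (@continuous_FTC2 _ f P)//.
  - by apply: continuous_in_subspaceT => z; rewrite inE/= in_itv => /uvab; exact: cf.
  - have cP z : u <= z <= v -> {for z, continuous P}.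
      move=> /uvab zab; have [dPz _] := dP z zab.
      exact: derivable_continuous.
    split=> [z||].
    + rewrite in_itv/= => /andP[uz zv].
      by have [] := dP z (uvab z _); [rewrite !ltW|].
    + by apply: cvg_at_right_filter; apply: cP; rewrite lexx ltW.
    + by apply: cvg_at_left_filter; apply: cP; rewrite lexx ltW.
  - move=> z; rewrite in_itv/= => /andP[uz zv]; rewrite derive1E.
    by have [] := dP z (uvab z _); [rewrite !ltW|].
move=> xab yab; case: (ltgtP x y) => [xy|yx|->]; first exact: le_case.
- by rewrite le_case// opprB.
- by rewrite set_itv1 Rintegral_set1 subrr.
Qed.
(** A simple zero is isolated, and a continuous function is nonzero near a point
    where it is nonzero. *)
Lemma neq0_neighborhood_of_segment G (c : R) : (forall x, derivable G x 1) ->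
  G 0 = 0 -> derive1 G 0 != 0 -> c != 0 ->
  (forall x, Num.min c 0 <= x <= Num.max c 0 -> x != 0 -> G x != 0) ->
  exists a b, [/\ a < 0 < b, a < c < b
    & forall x, a < x < b -> x != 0 -> G x != 0].
Proof.
move=> dG G0 G'0 c0 Gseg.
have [e1 e10 He1] : exists2 e, 0 < e &
    forall x, 0 - e < x < 0 + e -> x != 0 -> G x != 0.
  apply/(near_itvP 0 (fun x => x != 0 -> G x != 0)).
  have cv := cvg_quotient_derive1 (dG 0) G0.
  have nz := cvgr_neq0 (derive1 G 0) cv G'0; rewrite near_withinE in nz.
  near=> x => x0; have : x^-1 * G x != 0 by move: x0; near: x; exact: nz.
  by rewrite mulf_eq0 negb_or => /andP[].
have Gc : G c != 0.
  by apply: Gseg => //; rewrite ge_min le_max lexx.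
have [e2 e20 He2] := (near_itvP c (fun x => G x != 0)).1
  (cvgr_neq0 (G c) (derivable_continuous (dG c)) Gc).
pose e := Num.min e1 e2; have e0 : 0 < e by rewrite lt_min e10.
have [ee1 ee2] : e <= e1 /\ e <= e2 by rewrite !ge_min !lexx orbT.
exists (Num.min c 0 - e), (Num.max c 0 + e); split.
- by case: (ltP c 0) => ?; apply/andP; split; lra.
- by case: (ltP c 0) => ?; apply/andP; split; lra.
move=> x /andP[x1 x2] x0.
have [xm|mx] := ltP x (Num.min c 0).
  move: x1 xm; case: (ltP c 0) => ? ? ?.
    by apply: He2; apply/andP; split; lra.
  by apply: He1 => //; apply/andP; split; lra.
have [xM|Mx] := leP x (Num.max c 0); first by apply: Gseg => //; rewrite mx.
move: x2 Mx; case: (ltP c 0) => ? ? ?.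
  by apply: He1 => //; apply/andP; split; lra.
by apply: He2; apply/andP; split; lra.
Unshelve. all: by end_near. Qed.

Lemma smooth_near_continuous f x : smooth_near f x -> {for x, continuous f}.
Proof. by move=> sf; exact: (derivable_continuous (nbhs_singleton sf 0%N)). Qed.

(** The integrand is continuous on an open interval around [0] and [c y0], so
    that the slow divergence integral is a primitive composed with [c]. One factor
    [derive1 F (c y)] cancels against the derivative of [c], since [F (c y) = y]. *)
Lemma slow_divergence_derive F G c y0 : smooth F -> smooth G ->
  derive1 F 0 = 0 -> G 0 = 0 -> derive1 G 0 != 0 ->
  smooth_near c y0 -> (\forall y \near y0, F (c y) = y) ->
  c y0 != 0 ->
  (forall x, Num.min (c y0) 0 <= x <= Num.max (c y0) 0 -> x != 0 -> G x != 0) ->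
  \forall y \near y0,
    is_derive (y : R) 1 (slow_divergence F G c) (derive1 F (c y) / G (c y)).
Proof.
move=> sF sG F'0 G0 G'0 sc Fc c0 Gseg.
pose f x := derive1 F x ^+ 2 / G x.
have dF x : derivable F x 1 := sF 0%N x.
have dG x : derivable G x 1 := sG 0%N x.
have dF' x : derivable (derive1 F) x 1 := sF 1%N x.
have [a [b [ab0 abc Gneq0]]] := neq0_neighborhood_of_segment dG G0 G'0 c0 Gseg.
have cf x : a < x < b -> {for x, continuous f}.
  move=> xab; have [->|x0] := eqVneq x 0.
    exact: (continuous_at_simple_zeros (dF' 0) (dG 0) F'0 G0 G'0).
  have cF' := derivable_continuous (dF' x).
  apply: (@continuousM _ _ (fun x => derive1 F x ^+ 2) (fun x => (G x)^-1)).
    exact: (@continuousM _ _ (derive1 F) (derive1 F) _ cF' cF').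
  apply: continuousV; first exact: Gneq0.
  exact: (derivable_continuous (dG x)).
move: ab0 abc => /andP[a0 b0] /andP[ac cb].
(* The primitive lives on a compact interval strictly inside the one where the
   integrand is known to be continuous. *)
pose a' := (a + Num.min 0 (c y0)) / 2; pose b' := (b + Num.max 0 (c y0)) / 2.
have [aa' a'0 a'c] : [/\ a < a', a' < 0 & a' < c y0].
  by rewrite /a'; case: (ltP 0 (c y0)) => ?; split; lra.
have [bb' b'0 b'c] : [/\ b' < b, 0 < b' & c y0 < b'].
  by rewrite /b'; case: (ltP 0 (c y0)) => ?; split; lra.
have sub x : a' <= x <= b' -> a < x < b.
  by move=> /andP[ax xb]; rewrite (lt_le_trans aa')// (le_lt_trans xb).
have [P dP] := is_derive_primitive (lt_trans a'0 b'0) (fun x xab => cf x (sub x xab)).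
have cc := smooth_near_continuous sc.
have c_in : \forall y \near y0, a' < c y < b'.
  have ca := cvgr_gt (c y0) cc _ a'c; have cb' := cvgr_lt (c y0) cc _ b'c.
  near=> y; apply/andP; split; near: y; [exact: ca|exact: cb'].
have ab0 : a' < 0 < b' by rewrite a'0.
have sdE : \forall y \near y0, P (c y) - P 0 = slow_divergence F G c y.
  apply: filterS c_in => y cy; rewrite /slow_divergence -/f.
  rewrite (@oriented_integralE f P a' b' (c y) 0)// ?opprB// => z /andP[az zb].
  by apply: cf; apply: sub; rewrite !ltW.
have c_neq0 : \forall y \near y0, c y != 0.
  exact: (cvgr_neq0 (c y0) cc c0).
have /near_join sdE2 := sdE; have /near_join Fc2 := Fc.
near=> y.
have cy : a' < c y < b' by near: y; exact: c_in.
have dc : is_derive y 1 c (derive1 c y).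
  rewrite derive1E; apply: derivableP.
  suff : forall n, derivable (derive1n n c) y 1 by move=> /(_ 0%N).
  by near: y; exact: sc.
have Fc' : derive1 F (c y) * derive1 c y = 1.
  have dFc : is_derive (c y) 1 F (derive1 F (c y)).
    by rewrite derive1E; apply: derivableP; exact: dF.
  have [_] := is_derive1_comp dFc dc.
  rewrite (@near_eq_derive _ _ _ _ id y 1); first by rewrite derive_id => ->.
  by near: y; exact: Fc2.
have cab : a' < c y < b' := cy.
have dPc := is_derive1_comp (dP _ cab) dc.
have Gcy : G (c y) != 0.
  apply: Gneq0; last by near: y; exact: c_neq0.
  by apply: sub; case/andP: cy => /ltW -> /ltW ->.
have -> : derive1 F (c y) / G (c y) = f (c y) * derive1 c y - 0.
  rewrite -[LHS]mulr1 -Fc' /f; field.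
  exact: Gcy.
apply: (near_eq_is_derive _ (is_deriveB dPc (is_derive_cst (P 0) y 1))).
by near: y; exact: sdE2.
Unshelve. all: by end_near. Qed.
Lemma ndiff_of_is_derive n f (g : R -> R) a :
  (\forall y \near a, is_derive (y : R) 1 f (g y)) -> ndiff n g a ->
  ndiff n.+1 f a.
Proof.
move=> dfg ng; apply/ndiffS; split; first by apply: filterS dfg => y [].
apply: ndiff_near_eq ng; apply: filterS dfg => y [_ <-].
by rewrite derive1E.
Qed.

Lemma ndiff_slow_divergence_derivative n F G c y0 : smooth F -> smooth G ->
  smooth_near c y0 -> G (c y0) != 0 ->
  ndiff n (fun y => derive1 F (c y) / G (c y)) y0.
Proof.
move=> sF sG sc Gc.
have sF' : smooth (derive1 F) by move=> k x; rewrite -derive1Sn; exact: sF.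
have nc : ndiff n c y0 := ndiff_smooth_near sc.
have cG : {for y0, continuous (fun y => G (c y))}.
  apply: (@continuous_comp _ _ _ c G); first exact: smooth_near_continuous.
  exact: (derivable_continuous (sG 0%N (c y0))).
exact: (ndiffM (ndiff_smooth_comp sF' nc) (ndiffV cG Gc (ndiff_smooth_comp sG nc))).
Qed.
End SlowDivergenceIntegral.

(** * Measure of neighborhoods of a sequence *)

Section Minkowski.
Set Implicit Arguments.
Unset Strict Implicit.
Unset Printing Implicit Defensive.
Context {R : realType}.
Implicit Types (U : set R) (u : R^nat) (a c d p s x delta : R).

Lemma closed_neighborhoodI U delta x y : U y -> `|x - y| <= delta ->
  closed_neighborhood U delta x.
Proof.
move=> Uy xy; apply: (@le_trans _ _ (edist (x, y))).
  by apply: ereal_inf_lbound; exists y.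
apply/lee_addgt0Pr => e e0; rewrite -EFinD; apply: edist_fin => /=.
  by rewrite ltr_wpDl// (le_trans _ xy).
by rewrite -ball_normE /ball_/= (le_lt_trans xy)// ltrDl.
Qed.

Lemma closed_neighborhoodE U delta delta' x : closed_neighborhood U delta x ->
  delta < delta' -> exists2 y, U y & `|x - y| < delta'.
Proof.
move=> Ux dd; have /ereal_inf_lt[_ [y Uy <-] /edist_lt_ball] :
  (edist_inf U x < delta'%:E)%E by rewrite (le_lt_trans Ux)// lte_fin.
by rewrite -ball_normE /ball_/= => xy; exists y.
Qed.

Lemma measurable_closed_neighborhood U delta :
  measurable (closed_neighborhood U delta : set (measurableTypeR R)).
Proof.
apply: measurable_realfun.closed_measurable.
have -> : closed_neighborhood U delta =
    edist_inf U @^-1` [set z | (z <= delta%:E)%E] by [].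
apply: closed_comp; first by move=> x _; exact: edist_inf_continuous.
exact: closed_ereal_ge_ereal.
Qed.

Lemma lebesgue_measure_cover (A : set R) u n r a b :
  measurable (A : set (measurableTypeR R)) -> 0 <= r -> a <= b ->
  A `<=` `[a, b] `|` [set x | exists2 l, (l < n)%N & `|x - u l| <= r] ->
  (lebesgue_measure A <= (b - a + n%:R * (2 * r))%:E)%E.
Proof.
move=> mA r0 ab Asub.
pose F l : set (measurableTypeR R) :=
  if (l < n)%N then `[u l - r, u l + r] else `[a, b].
have mF k : `I_n.+1 k -> measurable (F k).
  by move=> _; rewrite /F; case: ifP => _; exact: measurable_itv.
have AF : (A : set (measurableTypeR R)) `<=` \big[setU/set0]_(k < n.+1) F k.
  move=> x /Asub; rewrite big_ord_recr/= {2}/F ltnn => -[xab|[l ln xl]].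
    by right.
  left; rewrite -bigcup_mkord; exists l => //=.
  rewrite /F ln/= in_itv/= lerBlDr -lerBlDl addrC -lerBlDr.
  move: xl; rewrite ler_distl => /andP[xl lx].
  by rewrite lerBlDr addrC; apply/andP; split; lra.
apply: (le_trans (content_subadditive lebesgue_measure mF mA AF)).
have Fl l : (lebesgue_measure (F l) <=
    (if (l < n)%N then 2 * r else b - a)%:E)%E.
  rewrite /F; case: ifP => _; rewrite lebesgue_measure_itv/= lte_fin;
    case: ifP => _; rewrite ?lee_fin//; lra.
apply: (@le_trans _ _ (\sum_(k < n.+1) (if (k < n)%N then 2 * r else b - a)%:E)%E).
  by apply: lee_sum => i _; exact: Fl.
rewrite big_ord_recr/= ltnn (eq_bigr (fun=> (2 * r)%:E)); last first.
  by move=> i _; rewrite ltn_ord.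
rewrite sumEFin -EFinD lee_fin sumr_const card_ord -[_ *+ n]mulr_natl; lra.
Qed.

(** The terms closer to [a] than [t = delta `^ (1 + p)^-1] lie in a single
    interval of length [t]. At most about [t `^ (- p)] terms are left, and covering
    each of them by an interval of length comparable to [delta = t `^ (1 + p)]
    costs a total length comparable to [t] again. *)
Lemma closed_neighborhood_measure_le u a p c N : 0 < p -> 0 < c ->
  (forall l, a < u l) ->
  (forall l, c * l%:R <= (u (N + l)%N - a) `^ (- p)) ->
  exists2 C, 0 < C & forall delta, 0 < delta <= 1 ->
    (lebesgue_measure (closed_neighborhood (range u) delta) <=
       (C * delta `^ (1 + p)^-1)%:E)%E.
Proof.
(* With intervals of radius [2 * delta] and [delta <= t], the tail costs at most
   [5 * t], the first [N + 1] terms [4 * (N + 1) * t], and the remaining ones,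
   at most [t `^ (- p) / c] in number, at most [4 * t / c]. *)
move=> p0 c0 au cu; exists (9 + 4 * N%:R + 4 * c^-1).
  by rewrite addr_gt0 ?mulr_gt0 ?invr_gt0// ltr_wpDr// mulr_ge0.
move=> delta /andP[d0 d1]; set t := delta `^ _.
have p1 : 0 < 1 + p by lra.
have t0 : 0 < t by rewrite powR_gt0.
have t1 : t <= 1.
  have <- : 1 `^ (1 + p)^-1 = 1 :> R by rewrite powR1.
  by rewrite ge0_ler_powR ?nnegrE ?invr_ge0// ltW.
have dt : delta = t * t `^ p.
  transitivity (t `^ (1 + p)); last by rewrite powRD ?powRr1 ?ltW ?gt_eqF.
  by rewrite /t -powRrM mulVf ?gt_eqF// powRr1// ltW.
have tp0 : 0 < t `^ p by rewrite powR_gt0.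
have dlet : delta <= t.
  rewrite {1}dt ger_pMr//; have <- : 1 `^ p = 1 :> R by rewrite powR1.
  by rewrite ge0_ler_powR ?nnegrE// ltW.
pose M := Num.trunc ((t `^ p)^-1 / c).
have tc0 : 0 <= (t `^ p)^-1 / c by rewrite divr_ge0 ?invr_ge0 ?ltW.
have /andP[M1 M2] := truncn_itv tc0; rewrite -/M in M1 M2.
pose n := (N + M.+1)%N.
have small l : (n <= l)%N -> u l - a < t.
  move=> nl; have -> : l = (N + (l - N))%N by rewrite subnKC// (leq_trans _ nl)// leq_addr.
  have := cu (l - N)%N; set w := u _ - a => cw.
  have w0 : 0 < w by rewrite subr_gt0.
  rewrite ltNge; apply/negP => tw.
  have wt : w `^ (- p) <= (t `^ p)^-1.
    by rewrite powRN lef_pV2 ?posrE ?powR_gt0// ge0_ler_powR ?nnegrE// ?ltW.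
  have : c * (l - N)%:R <= (t `^ p)^-1 by exact: le_trans wt.
  rewrite leNgt => /negP; apply.
  move: M2; rewrite ltr_pdivrMr// mulrC => /lt_le_trans; apply.
  by rewrite ler_pM2l// ler_nat leq_subRL ?(leq_trans _ nl)// leq_addr.
have sub : closed_neighborhood (range u) delta `<=`
    `[a - 2 * delta, a + t + 2 * delta] `|`
    [set x | exists2 l, (l < n)%N & `|x - u l| <= 2 * delta].
  move=> x /closed_neighborhoodE -/(_ (2 * delta))[|_ [l _ <-] xl].
    by lra.
  have [ln|nl] := ltnP l n; first by right; exists l => //; exact: ltW.
  left; rewrite /= in_itv/=; move: xl; rewrite ltr_distl => /andP[xl lx].
  have := small _ nl; have := au l => ? ?.
  by apply/andP; split; lra.
have d2 : 0 <= 2 * delta by lra.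
apply: le_trans (lebesgue_measure_cover (measurable_closed_neighborhood _ _) d2 _ sub) _.
  by lra.
rewrite lee_fin /n natrD -natr1.
have Md : M%:R * delta <= t / c.
  apply: (@le_trans _ _ ((t `^ p)^-1 / c * delta)).
    by rewrite ler_pM2r.
  by rewrite {1}dt le_eqVlt; apply/orP; left; apply/eqP; field; rewrite !gt_eqF.
have Nd : N%:R * delta <= N%:R * t by rewrite ler_wpM2l.
nra.
Qed.

(** A gap of the sequence whose lower end [z] satisfies
    [c * (z - a) ^+ k <= delta] has length at most [delta]. Hence the closed
    neighborhood contains the whole interval from [a] to
    [a + (delta / c) `^ k%:R^-1]. *)
Lemma closed_neighborhood_measure_ge u a c k N : (0 < k)%N -> 0 < c ->
  nonincreasing_seq u -> (forall l, a < u l) -> u @ \oo --> a ->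
  (forall l, (N <= l)%N -> u l - u l.+1 <= c * (u l.+1 - a) ^+ k) ->
  \forall delta \near 0^'+, (((delta / c) `^ k%:R^-1)%:E <=
     lebesgue_measure (closed_neighborhood (range u) delta))%E.
Proof.
move=> k0 c0 nu au ua gap.
have kR0 : 0 < k%:R :> R by rewrite ltr0n.
have uN0 : 0 < u N - a by rewrite subr_gt0.
near=> delta.
have d0 : 0 < delta by near: delta; exact: nbhs_right_gt.
set w := _ `^ _.
have dc0 : 0 < delta / c by rewrite divr_gt0.
have w0 : 0 < w by rewrite powR_gt0.
have wk : w ^+ k = delta / c.
  by rewrite -powR_mulrn ?ltW// /w -powRrM mulVf ?gt_eqF// powRr1 ?ltW.
have wN : w < u N - a.
  rewrite -(ltr_pXn2r k0) ?nnegrE ?ltW// wk ltr_pdivrMr//.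
  near: delta; apply: nbhs_right_lt.
  by rewrite mulr_gt0// exprn_gt0.
have sub : `]a, (a + w)] `<=` closed_neighborhood (range u) delta.
  move=> z; rewrite /= in_itv/= => /andP[az zw].
  have ex : exists l, u l < z.
    have [M _ uM] := cvgr_lt a ua _ az.
    by exists M; apply: (uM M); exact: leqnn.
  have uNz : z < u N by lra.
  (* The first term below [z] is the lower end of the gap that contains [z]. *)
  case: (ex_minnP ex) => -[|l] ul minl.
    have : u N <= u 0%N by apply: nu.
    by move: ul uNz => /lt_trans /[apply]; rewrite ltNge => /negP.
  have zl : z <= u l by rewrite leNgt; apply/negP => /minl; rewrite ltnn.
  have Nl : (N <= l)%N.
    rewrite leqNgt; apply/negP => lN; have := nu _ _ lN.
    by rewrite leNgt => /negP; apply; exact: lt_trans ul _.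
  apply: (@closed_neighborhoodI _ _ _ (u l)); first by exists l.
  rewrite distrC ger0_norm ?subr_ge0//.
  apply: (@le_trans _ _ (u l - u l.+1)); first by rewrite lerB// ltW.
  apply: (le_trans (gap _ Nl)).
  have -> : delta = c * w ^+ k by rewrite wk mulrC divfK ?gt_eqF.
  rewrite ler_pM2l// lerXn2r ?nnegrE ?subr_ge0 ?(ltW (au _)) ?ltW// => //.
  by have := ltW ul; lra.
have <- : lebesgue_measure (`]a, (a + w)] : set R) = w%:E.
  by rewrite lebesgue_measure_itv/= lte_fin ltrDl w0 -EFinB addrAC subrr add0r.
apply: le_measure => //.
- by rewrite inE; exact: measurable_itv.
- by rewrite inE; exact: measurable_closed_neighborhood.
Unshelve. all: by end_near. Qed.
End Minkowski.

(** * Minkowski contents *)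

Section MinkowskiContent.
Set Implicit Arguments.
Unset Strict Implicit.
Unset Printing Implicit Defensive.
Context {R : realType}.
Implicit Types (U : set R) (u : R^nat) (a b c d e p q s delta : R).

Lemma minkowski_ratio_ge0 U s delta : (0 <= minkowski_ratio U s delta)%E.
Proof. by rewrite mule_ge0// lee_fin invr_ge0 powR_ge0. Qed.

Lemma lower_minkowski_content_ge U s e :
  (\forall delta \near 0^'+, ((e * delta `^ (1 - s))%:E <=
     lebesgue_measure (closed_neighborhood U delta))%E) ->
  (e%:E <= lower_minkowski_content s U)%E.
Proof.
move=> near_e; rewrite /lower_minkowski_content limf_einfE.
apply: le_ereal_sup_tmp; exists (ereal_inf (minkowski_ratio U s @`
  [set delta | 0 < delta /\ ((e * delta `^ (1 - s))%:E <=
     lebesgue_measure (closed_neighborhood U delta))%E])).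
  exists [set delta | 0 < delta /\ ((e * delta `^ (1 - s))%:E <=
     lebesgue_measure (closed_neighborhood U delta))%E] => //.
  by near=> delta; split; near: delta; [exact: nbhs_right_gt|].
apply: le_ereal_inf_tmp => _ [delta [d0 ed] <-].
by rewrite /minkowski_ratio lee_pdivlMr ?powR_gt0// -EFinM.
Unshelve. all: by end_near. Qed.

Lemma upper_minkowski_content_le U s c :
  (\forall delta \near 0^'+, (lebesgue_measure (closed_neighborhood U delta) <=
     (c * delta `^ (1 - s))%:E)%E) ->
  (upper_minkowski_content s U <= c%:E)%E.
Proof.
move=> near_c; rewrite /upper_minkowski_content limf_esupE.
pose V := [set delta : R | 0 < delta /\
  (lebesgue_measure (closed_neighborhood U delta) <=
     (c * delta `^ (1 - s))%:E)%E].
apply: (@le_trans _ _ (ereal_sup (minkowski_ratio U s @` V))).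
  apply: ereal_inf_lbound; exists V => //.
  by near=> delta; split; near: delta; [exact: nbhs_right_gt|].
apply: ge_ereal_sup => _ [delta [d0 cd] <-].
by rewrite /minkowski_ratio lee_pdivrMr ?powR_gt0// -EFinM.
Unshelve. all: by end_near. Qed.

Lemma lower_upper_minkowski_content U s :
  (lower_minkowski_content s U <= upper_minkowski_content s U)%E.
Proof.
rewrite /lower_minkowski_content /upper_minkowski_content limf_einfE limf_esupE.
apply: ge_ereal_sup => _ [V V0 <-]; apply: le_ereal_inf_tmp => _ [W W0 <-].
have [delta [Vd Wd]] : exists delta, (V `&` W) delta.
  exact: (@filter_ex _ (0 : R)^'+ _ _ (filterI V0 W0)).
apply: (@le_trans _ _ (minkowski_ratio U s delta)).
  by apply: ereal_inf_lbound; exists delta.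
by apply: ereal_sup_ubound; exists delta.
Qed.

Lemma lower_minkowski_content_ge0 U s : (0 <= lower_minkowski_content s U)%E.
Proof.
rewrite /lower_minkowski_content limf_einfE; apply: le_ereal_sup_tmp.
exists (ereal_inf (minkowski_ratio U s @` setT)).
  by exists setT => //; exact: filterT.
by apply: le_ereal_inf_tmp => _ [delta _ <-]; exact: minkowski_ratio_ge0.
Qed.

Lemma upper_minkowski_content_eq0 U s c q : 0 <= c -> 1 - s < q ->
  (\forall delta \near 0^'+, (lebesgue_measure (closed_neighborhood U delta) <=
     (c * delta `^ q)%:E)%E) ->
  upper_minkowski_content s U = 0%E.
Proof.
move=> c0 sq near_c; apply/eqP; rewrite eq_le; apply/andP; split; last first.
  by rewrite (le_trans (lower_minkowski_content_ge0 _ _) (lower_upper_minkowski_content _ _)).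
apply/lee_addgt0Pr => e e0; rewrite add0e.
have qs : 0 < q - (1 - s) by rewrite subr_gt0.
apply: upper_minkowski_content_le; near=> delta.
have d0 : 0 < delta by near: delta; exact: nbhs_right_gt.
apply: (@le_trans _ _ (c * delta `^ q)%:E); first by near: delta.
have -> : delta `^ q = delta `^ (q - (1 - s)) * delta `^ (1 - s).
  by rewrite -powRD ?subrK// (gt_eqF d0) implybT.
rewrite lee_fin mulrA ler_pM2r ?powR_gt0//.
near: delta.
have : c * x `^ (q - (1 - s)) @[x --> 0^'+] --> c * 0.
  by apply: cvgM; [exact: cvg_cst|exact: powR_cvg0].
rewrite mulr0 => /cvgr_lt /(_ _ e0).
by apply: filterS => x /ltW.
Unshelve. all: by end_near. Qed.

(** Both dimensions are infima of sets lying between the open and the closed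
    half-line starting at [d], because the lower content is at most the upper. *)
Lemma has_box_dimP U d : 0 <= d ->
  (forall s, 0 <= s < d -> (0 < lower_minkowski_content s U)%E) ->
  (forall s, d < s -> upper_minkowski_content s U = 0%E) ->
  has_box_dim U d.
Proof.
move=> d0 lowU upU.
have inf_threshold (S : set R) : (forall s, S s -> d <= s) ->
    (forall s, d < s -> S s) -> inf S = d.
  move=> Sd dS; apply/eqP; rewrite eq_le; apply/andP; split; last first.
    by apply: lb_le_inf => //; exists (d + 1); apply: dS; rewrite ltrDl.
  apply/ler_addgt0Pr => e e0; apply: ge_inf; first by exists d.
  by apply: dS; rewrite ltrDl.
have lu s := lower_upper_minkowski_content U s.
split; apply: inf_threshold => s.
- move=> [s0 ls]; rewrite leNgt; apply/negP => sd.
  by have := lowU s; rewrite s0 sd ls ltxx => /(_ isT).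
- move=> ds; split; first by rewrite (le_trans d0)// ltW.
  apply/eqP; rewrite eq_le lower_minkowski_content_ge0 andbT.
  by rewrite (le_trans (lu s))// upU.
- move=> [s0 us]; rewrite leNgt; apply/negP => sd.
  by have := lowU s; rewrite s0 sd => /(_ isT); rewrite ltNge -us lu.
- by move=> ds; split; [rewrite (le_trans d0)// ltW|exact: upU].
Qed.
End MinkowskiContent.

(** * Box dimension of monotone sequences *)

Section BoxDimensionOfSequences.
Set Implicit Arguments.
Unset Strict Implicit.
Unset Printing Implicit Defensive.
Context {R : realType}.
Implicit Types (u : R^nat) (a c p s x y : R).

Lemma mulrn_le_of_increments (w : R^nat) c : 0 <= w 0%N ->
  (forall l, w l + c <= w l.+1) -> forall l, c * l%:R <= w l.
Proof.
move=> w0 wS; elim=> [|l IH]; first by rewrite mulr0.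
by rewrite -natr1 mulrDr mulr1; apply: le_trans (wS l); rewrite lerD2r.
Qed.

(** Discrete form of [(x ^- k.+1)' >= c] along [x' = - c * x ^+ k.+2]. In terms
    of [X = x ^+ k.+1] and [Y = y ^+ k.+1] it says that [Y <= X - c * X ^+ 2]
    implies [X^-1 + c <= Y^-1]. *)
Lemma powRN_increment x y c k : 0 < y <= x -> 0 < c -> c * x ^+ k.+2 <= x - y ->
  x `^ (- k.+1%:R) + c <= y `^ (- k.+1%:R).
Proof.
move=> /andP[y0 yx] c0 gap; have x0 := lt_le_trans y0 yx.
rewrite !powR_invn ?(ltW x0) ?(ltW y0)//; set X := x ^+ k.+1; set Y := y ^+ k.+1.
have X0 : 0 < X by rewrite exprn_gt0.
have Y0 : 0 < Y by rewrite exprn_gt0.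
have YX : Y <= X - c * X ^+ 2.
  apply: (@le_trans _ _ (y * x ^+ k)).
    by rewrite /Y exprS ler_pM2l// lerXn2r ?nnegrE ?(ltW x0) ?(ltW y0).
  apply: (@le_trans _ _ ((x - c * x ^+ k.+2) * x ^+ k)).
    by rewrite ler_pM2r ?exprn_gt0// lerBrDr addrC -lerBrDr.
  by rewrite le_eqVlt; apply/orP; left; apply/eqP; rewrite /X !exprS; ring.
rewrite -[Y^-1]mul1r ler_pdivlMr//.
apply: (@le_trans _ _ ((X^-1 + c) * (X - c * X ^+ 2))).
  by rewrite ler_pM2l// addr_gt0 ?invr_gt0.
have -> : (X^-1 + c) * (X - c * X ^+ 2) = 1 - (c * X) ^+ 2.
  by field; rewrite gt_eqF.
by rewrite gerBl sqr_ge0.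
Qed.

Section GapsComparableToPower.
Variables (u : R^nat) (a : R).
Hypotheses (u_noninc : nonincreasing_seq u) (u_gt : forall l, a < u l)
  (u_cvg : u @ \oo --> a).

Let ua_gt0 l : 0 < u l - a. Proof. by rewrite subr_gt0. Qed.

(** The distances to [a] decay geometrically, so that for every [s > 0] their
    powers of exponent [- s] grow at least linearly. *)
Lemma box_dim_geometric_gaps c : 0 < c ->
  (\forall l \near \oo, c * (u l - a) <= u l - u l.+1) ->
  has_box_dim (range u) 0.
Proof.
move=> c0 [N _ gap]; apply: has_box_dimP => // s s0.
  by move: s0 => /andP[/le_lt_trans /[apply]]; rewrite ltxx.
set q := (1 + c) `^ s.
have q1 : 1 < q.
  have <- : 1 `^ s = 1 :> R by rewrite powR1.
  by rewrite gt0_ltr_powR ?nnegrE// ?ltrDl// addr_ge0// ltW.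
pose w l := (u (N + l)%N - a) `^ (- s).
have w0 l : 0 < w l by rewrite powR_gt0.
have wq l : q * w l <= w l.+1.
  rewrite /w !powRN /q ler_pdivrMr ?powR_gt0// mulrC.
  have c10 : 0 < 1 + c by rewrite addr_gt0.
  have ul0 := ua_gt0 (N + l.+1).
  rewrite ler_pdivlMr ?powR_gt0// -powRM ?(ltW c10) ?(ltW ul0)//.
  rewrite ge0_ler_powR ?nnegrE ?(mulr_ge0 (ltW c10) (ltW ul0)) ?(ltW (ua_gt0 _)) ?(ltW s0)//.
  have := gap (N + l)%N (leq_addr _ _); rewrite /= addnS.
  have := u_noninc (leqnSn (N + l)); nra.
have wm l : w 0%N <= w l.
  elim: l => // l; move=> /le_trans; apply; apply: le_trans (wq l).
  by rewrite ler_peMl ?ltW.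
have [C C0 mC] : exists2 C, 0 < C & forall delta, 0 < delta <= 1 ->
    (lebesgue_measure (closed_neighborhood (range u) delta) <=
       (C * delta `^ (1 + s)^-1)%:E)%E.
  apply: (@closed_neighborhood_measure_le _ _ a s ((q - 1) * w 0%N) N) => //.
    by rewrite mulr_gt0// subr_gt0.
  apply: mulrn_le_of_increments => [|l]; first exact: powR_ge0.
  apply: le_trans (wq l); have := wm l; rewrite -/(w l) -subr_ge0; nra.
apply: (@upper_minkowski_content_eq0 _ _ s C (1 + s)^-1); first exact: ltW.
  rewrite -[(1 + s)^-1]mul1r ltr_pdivlMr; last by lra.
  have : 0 < s * s by rewrite mulr_gt0.
  by lra.
near=> delta; apply: mC; apply/andP; split; near: delta.
  exact: nbhs_right_gt.
exact: nbhs_right_le.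
Unshelve. all: by end_near. Qed.

(** The powers of exponent [1 - m] of the distances to [a] grow at least linearly
    by [powRN_increment], so the number of terms farther than [t] from [a] is
    [O(t `^ (1 - m))] and the measure of the [delta]-neighborhood is of the exact
    order [delta `^ m%:R^-1]. *)
Lemma box_dim_power_gaps m c c' : (1 < m)%N -> 0 < c -> 0 < c' ->
  (\forall l \near \oo, c * (u l - a) ^+ m <= u l - u l.+1) ->
  (\forall l \near \oo, u l - u l.+1 <= c' * (u l.+1 - a) ^+ m) ->
  has_box_dim (range u) (1 - m%:R^-1) /\ minkowski_nondegenerate (range u).
Proof.
case: m => [//|[//|k]] _ c0 c'0 [N _ gap] [N' _ gap'].
set m := k.+2%:R : R.
have m0 : 0 < m by rewrite ltr0n.
have m1 : m^-1 <= 1 by rewrite invf_le1// ler1n.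
have [C C0 mC] : exists2 C, 0 < C & forall delta, 0 < delta <= 1 ->
    (lebesgue_measure (closed_neighborhood (range u) delta) <=
       (C * delta `^ m^-1)%:E)%E.
  have -> : m = 1 + k.+1%:R by rewrite /m -natr1 addrC.
  apply: (@closed_neighborhood_measure_le _ _ a _ c N) => //.
  apply: mulrn_le_of_increments => [|l]; first exact: powR_ge0.
  apply: powRN_increment => //.
    by rewrite ua_gt0/= lerB// u_noninc// addnS.
  rewrite opprB addrA subrK addnS; apply: gap; exact: leq_addr.
have upC : \forall delta \near 0^'+,
    (lebesgue_measure (closed_neighborhood (range u) delta) <=
       (C * delta `^ m^-1)%:E)%E.
  near=> delta; apply: mC; apply/andP; split; near: delta.
    exact: nbhs_right_gt.
  exact: nbhs_right_le.
have low := closed_neighborhood_measure_ge (ltn0Sn _) c'0 u_noninc u_gt u_cvg gap'.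
have lowc s : s <= 1 - m^-1 -> (0 < lower_minkowski_content s (range u))%E.
  rewrite lerBrDr addrC -lerBrDr => sm.
  apply: (@lt_le_trans _ _ (c'^-1 `^ m^-1)%:E).
    by rewrite lte_fin powR_gt0 ?invr_gt0.
  apply: lower_minkowski_content_ge; near=> delta.
  have d0 : 0 < delta by near: delta; exact: nbhs_right_gt.
  have d1 : delta <= 1 by near: delta; exact: nbhs_right_le.
  apply: (@le_trans _ _ ((delta / c') `^ m^-1)%:E); last by near: delta; exact: low.
  rewrite lee_fin powRM ?invr_ge0 ?(ltW c'0) ?(ltW d0)// mulrC.
  by rewrite ler_pM2r ?powR_gt0 ?invr_gt0// ger_powR ?d0.
split.
  apply: has_box_dimP => [|s /andP[_ sd]|s ds].
  - by rewrite subr_ge0.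
  - by apply: lowc; rewrite ltW.
  - apply: (@upper_minkowski_content_eq0 _ _ s C m^-1); [exact: ltW| |exact: upC].
    by rewrite ltrBlDr addrC -ltrBlDr.
exists (1 - m^-1); first by rewrite subr_ge0.
split; [exact: lowc|exact: lower_upper_minkowski_content|].
apply: (@le_lt_trans _ _ C%:E); last exact: ltry.
by apply: upper_minkowski_content_le; rewrite opprB addrC subrK.
Unshelve. all: by end_near. Qed.

(** The gaps being smaller than every power of the distance to [a], the measure
    of the [delta]-neighborhood is larger than every positive power of [delta]. *)
Lemma box_dim_flat_gaps :
  (forall k, (0 < k)%N ->
    \forall l \near \oo, u l - u l.+1 <= (u l.+1 - a) ^+ k) ->
  has_box_dim (range u) 1.
Proof.
move=> gap; apply: has_box_dimP => // s.
  move=> /andP[_ s1].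
  have s10 : 0 < 1 - s by rewrite subr_gt0.
  pose k := (Num.trunc (1 - s)^-1).+1.
  have k0 : 0 < k%:R :> R by rewrite ltr0n.
  have sk : k%:R^-1 <= 1 - s.
    by rewrite -[1 - s]invrK lef_pV2 ?posrE ?invr_gt0// ltW// truncnS_gt.
  have [N _ gapk] := gap k isT.
  have low : \forall delta \near 0^'+, (((delta / 1) `^ k%:R^-1)%:E <=
     lebesgue_measure (closed_neighborhood (range u) delta))%E.
    apply: (@closed_neighborhood_measure_ge _ u a 1 k N) => // l Nl.
    by rewrite mul1r; exact: gapk.
  apply: (@lt_le_trans _ _ 1%:E); first by rewrite lte_fin.
  apply: lower_minkowski_content_ge; near=> delta.
  have d0 : 0 < delta by near: delta; exact: nbhs_right_gt.
  have d1 : delta <= 1 by near: delta; exact: nbhs_right_le.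
  apply: (@le_trans _ _ ((delta / 1) `^ k%:R^-1)%:E); last by near: delta; exact: low.
  by rewrite lee_fin mul1r divr1 ger_powR ?d0.
move=> s1.
have uc : 0 <= u 0%N - a + 4 by have := ua_gt0 0%N; lra.
apply: (@upper_minkowski_content_eq0 _ _ s _ 0 uc); first by lra.
near=> delta.
have d0 : 0 < delta by near: delta; exact: nbhs_right_gt.
have d1 : delta <= 1 by near: delta; exact: nbhs_right_le.
rewrite powRr0 mulr1.
apply: (le_trans (@lebesgue_measure_cover _ _ u 0 0
  (a - 2 * delta) (u 0%N + 2 * delta) (measurable_closed_neighborhood _ _) _ _ _)) => //.
- by have := ua_gt0 0%N; lra.
- move=> x /closed_neighborhoodE -/(_ (2 * delta))[|_ [l _ <-]]; first by lra.
  rewrite ltr_distl => /andP[xl lx]; left; rewrite /= in_itv/=.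
  by have := u_noninc (leq0n l); have := u_gt l => ? ?; apply/andP; split; lra.
- by rewrite lee_fin mul0r addr0; lra.
Unshelve. all: by end_near. Qed.
End GapsComparableToPower.
End BoxDimensionOfSequences.

(** * Sequences with gaps given by a function *)

Section SequencesDecreasingToLimit.
Set Implicit Arguments.
Unset Strict Implicit.
Unset Printing Implicit Defensive.
Context {R : realType}.
Implicit Types (u : R^nat) (a c x y : R) (m k : nat).

Lemma near_seq_at_right u a (P : set R) : (forall l, a < u l) ->
  u @ \oo --> a -> (\forall x \near a^'+, P x) -> \forall l \near \oo, P (u l).
Proof.
move=> au ua /at_right_itvP[e e0 eP].
have ae : a < a + e by rewrite ltrDl.
apply: filterS (cvgr_lt a ua _ ae) => l ul; apply: eP.
by rewrite au.
Qed.

Lemma near_at_right_expr_le a c e k : 0 < e -> (0 < k)%N ->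
  \forall x \near a^'+, c * (x - a) ^+ k <= e.
Proof.
move=> e0; case: k => // k _.
have cv : c * (x - a) ^+ k.+1 @[x --> a] --> c * (a - a) ^+ k.+1.
  apply: cvgM; first exact: cvg_cst.
  apply: (@continuous_comp _ _ _ (fun x => x - a) (fun x => x ^+ k.+1)).
    by apply: cvgB; [exact: cvg_id|exact: cvg_cst].
  exact: exprn_continuous.
rewrite subrr expr0n mulr0 in cv.
by apply: cvg_within; apply: filterS (cvgr_lt 0 cv _ e0) => x /ltW.
Qed.

(** Since [m > 1], the gap is negligible with respect to the distance to [a]. *)
Lemma ratio_le2_of_gaps u a c m : (1 < m)%N -> (forall l, a < u l) ->
  u @ \oo --> a ->
  (\forall l \near \oo, u l - u l.+1 <= c * (u l - a) ^+ m) ->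
  \forall l \near \oo, u l - a <= 2 * (u l.+1 - a).
Proof.
move=> m1 au ua gap.
have h0 : 0 < 2^-1 :> R by rewrite invr_gt0.
have m0 : (0 < m.-1)%N by case: m m1 {gap} => [|[]].
have small := near_seq_at_right au ua (near_at_right_expr_le a c h0 m0).
apply: filterS2 gap small => l gapl smalll.
have ul : 0 < u l - a by rewrite subr_gt0.
have : c * (u l - a) ^+ m <= 2^-1 * (u l - a).
  by rewrite -(prednK (ltnW m1)) exprSr mulrA ler_pM2r.
by move=> ?; lra.
Qed.
End SequencesDecreasingToLimit.

Section GapsGivenByFunction.
Set Implicit Arguments.
Unset Strict Implicit.
Unset Printing Implicit Defensive.
Context {R : realType}.
Variables (u : R^nat) (a : R).
Hypotheses (u_noninc : nonincreasing_seq u) (u_gt : forall l, a < u l)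
  (u_cvg : u @ \oo --> a).
Variables (D : R -> R) (k1 k2 : R).
Hypotheses (k1_gt0 : 0 < k1) (k2_gt0 : 0 < k2).
Implicit Types (c : R) (k m l : nat).

Let ua_gt0 l : 0 < u l - a. Proof. by rewrite subr_gt0. Qed.

Let u_cvgS : (fun l => u l.+1) @ \oo --> a.
Proof. by rewrite (cvg_shiftS u). Qed.

Let box_dim_gaps m c c' : (0 < m)%N -> 0 < c -> 0 < c' ->
  (\forall l \near \oo, c * (u l - a) ^+ m <= u l - u l.+1) ->
  ((1 < m)%N ->
    \forall l \near \oo, u l - u l.+1 <= c' * (u l.+1 - a) ^+ m) ->
  has_box_dim (range u) (1 - m%:R^-1) /\
  ((1 < m)%N -> minkowski_nondegenerate (range u)).
Proof.
move=> m0 c0 c'0 low up; have [m1|] := ltnP 1 m.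
  by have [] := box_dim_power_gaps u_noninc u_gt u_cvg m1 c0 c'0 low (up m1).
case: m m0 low {up} => [//|[_ low _|//]]; split=> //.
rewrite invr1 subrr; apply: (box_dim_geometric_gaps u_noninc u_gt c0).
by apply: filterS low => l; rewrite expr1.
Qed.

(** An orbit of the slow relation function has its gaps controlled by the value
    of [D] at the upper end of the gap, an orbit of the inverse by the value at the
    lower end. In both cases the bounds are transported to the end where they are
    needed, consecutive distances to [a] being comparable. *)
Section Forward.
Hypothesis gapD : forall l,
  k1 * (u l - u l.+1) <= D (u l) <= k2 * (u l - u l.+1).

Lemma box_dim_forward m c c' : (0 < m)%N -> 0 < c -> 0 < c' ->
  (\forall x \near a^'+, c * (x - a) ^+ m <= D x) ->
  (\forall x \near a^'+, D x <= c' * (x - a) ^+ m) ->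
  has_box_dim (range u) (1 - m%:R^-1) /\
  ((1 < m)%N -> minkowski_nondegenerate (range u)).
Proof.
move=> m0 c0 c'0 lowD upD.
have up : \forall l \near \oo, u l - u l.+1 <= c' / k1 * (u l - a) ^+ m.
  apply: filterS (near_seq_at_right u_gt u_cvg upD) => l Dl.
  rewrite mulrAC ler_pdivlMr// mulrC; apply: le_trans Dl.
  by case/andP: (gapD l).
apply: (@box_dim_gaps m (c / k2) (c' / k1 * 2 ^+ m)) => //.
- by rewrite divr_gt0.
- by rewrite mulr_gt0 ?exprn_gt0// divr_gt0.
- apply: filterS (near_seq_at_right u_gt u_cvg lowD) => l Dl.
  rewrite mulrAC ler_pdivrMr// [leRHS]mulrC; apply: le_trans Dl _.
  by case/andP: (gapD l).
- move=> m1; apply: filterS2 up (ratio_le2_of_gaps m1 u_gt u_cvg up) => l ul ul2.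
  apply: (le_trans ul); rewrite -[leRHS]mulrA ler_pM2l ?divr_gt0// -exprMn.
  by rewrite lerXn2r ?nnegrE ?mulr_ge0// ltW.
Qed.

Lemma box_dim_forward_flat :
  (forall k c, 0 < c -> \forall x \near a^'+, D x <= c * (x - a) ^+ k) ->
  has_box_dim (range u) 1.
Proof.
move=> flat.
have up k c : 0 < c ->
    \forall l \near \oo, u l - u l.+1 <= c * (u l - a) ^+ k.
  move=> c0; have ck0 : 0 < k1 * c by rewrite mulr_gt0.
  apply: filterS (near_seq_at_right u_gt u_cvg (flat k _ ck0)) => l Dl.
  rewrite -(ler_pM2l k1_gt0) mulrA; apply: le_trans Dl.
  by case/andP: (gapD l).
apply: (box_dim_flat_gaps u_noninc u_gt u_cvg) => k _.
(* The factor [2^-1 ^+ k] absorbs the passage to the lower end of the gap. *)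
have c0 : 0 < 2^-1 ^+ k :> R by rewrite exprn_gt0 ?invr_gt0.
have r2 := ratio_le2_of_gaps (isT : (1 < 2)%N) u_gt u_cvg (up 2%N 1 ltr01).
apply: filterS2 (up k _ c0) r2 => l ul ul2.
apply: (le_trans ul); rewrite -exprMn lerXn2r ?nnegrE ?mulr_ge0 ?invr_ge0 ?(ltW (ua_gt0 _))//.
by rewrite ler_pdivrMl.
Qed.

End Forward.

Section Backward.
Hypothesis gapD : forall l,
  k1 * (u l - u l.+1) <= D (u l.+1) <= k2 * (u l - u l.+1).

Lemma box_dim_backward m c c' : (0 < m)%N -> 0 < c -> 0 < c' ->
  (\forall x \near a^'+, c * (x - a) ^+ m <= D x) ->
  (\forall x \near a^'+, D x <= c' * (x - a) ^+ m) ->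
  has_box_dim (range u) (1 - m%:R^-1) /\
  ((1 < m)%N -> minkowski_nondegenerate (range u)).
Proof.
move=> m0 c0 c'0 lowD upD; have u_gtS l := u_gt l.+1.
pose C := c' / k1; have C0 : 0 < C by rewrite divr_gt0.
have C10 : 0 < 1 + C by rewrite addr_gt0.
have up : \forall l \near \oo, u l - u l.+1 <= C * (u l.+1 - a) ^+ m.
  apply: filterS (near_seq_at_right u_gtS u_cvgS upD) => l Dl.
  rewrite /C mulrAC ler_pdivlMr// mulrC; apply: le_trans Dl.
  by case/andP: (gapD l).
apply: (@box_dim_gaps m (c / k2 / (1 + C) ^+ m) C) => //.
  by rewrite !divr_gt0 ?exprn_gt0.
have powle (y : R) : 0 <= y -> y <= 1 -> y ^+ m <= y.
  by case: m m0 {lowD upD up} => // k _ y0 y1; rewrite exprS ler_piMr// exprn_ile1.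
have lt1 : \forall l \near \oo, u l.+1 - a <= 1.
  have := near_at_right_expr_le a 1 ltr01 (ltn0Sn 0).
  move=> /(near_seq_at_right u_gtS u_cvgS); apply: filterS => l.
  by rewrite mul1r expr1.
near=> l.
have ul : u l - a <= (1 + C) * (u l.+1 - a).
  have gap : u l - u l.+1 <= C * (u l.+1 - a) ^+ m by near: l; exact: up.
  have : C * (u l.+1 - a) ^+ m <= C * (u l.+1 - a).
    by rewrite ler_pM2l// powle ?(ltW (ua_gt0 _))//; near: l; exact: lt1.
  by move=> ?; lra.
apply: (@le_trans _ _ (c / k2 * (u l.+1 - a) ^+ m)).
  rewrite -!mulrA !ler_pM2l ?invr_gt0// -exprVn -exprMn.
  rewrite lerXn2r ?nnegrE ?mulr_ge0 ?invr_ge0 ?(ltW (ua_gt0 _)) ?(ltW C10)//.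
  by rewrite ler_pdivrMl.
have Dl : c * (u l.+1 - a) ^+ m <= D (u l.+1).
  by near: l; exact: (near_seq_at_right u_gtS u_cvgS lowD).
rewrite mulrAC ler_pdivrMr// [leRHS]mulrC; apply: le_trans Dl _.
by case/andP: (gapD l).
Unshelve. all: by end_near. Qed.

Lemma box_dim_backward_flat :
  (forall k c, 0 < c -> \forall x \near a^'+, D x <= c * (x - a) ^+ k) ->
  has_box_dim (range u) 1.
Proof.
move=> flat; have u_gtS l := u_gt l.+1.
apply: (box_dim_flat_gaps u_noninc u_gt u_cvg) => k _.
apply: filterS (near_seq_at_right u_gtS u_cvgS (flat k _ k1_gt0)) => l Dl.
rewrite -(ler_pM2l k1_gt0); apply: le_trans Dl.
by case/andP: (gapD l).
Qed.

End Backward.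
End GapsGivenByFunction.

(** * Dynamics of the slow relation function *)

Section SlowRelationDynamics.
Set Implicit Arguments.
Unset Strict Implicit.
Unset Printing Implicit Defensive.
Context {R : realType}.

Lemma bilipschitz_of_derive_lt0 (f g : R -> R) (a : R) :
  (\forall y \near a, is_derive (y : R) 1 f (g y)) ->
  {for a, continuous g} -> g a < 0 ->
  exists k1 k2, [/\ 0 < k1, 0 < k2 & exists2 e, 0 < e &
    forall x y, a - e < x -> x <= y -> y < a + e ->
      k1 * (y - x) <= f x - f y <= k2 * (y - x)].
Proof.
move=> dfg cg ga; exists (- g a / 2), (- g a * 2).
split; [by lra|by lra|].
have lo : 2 * g a < g a by lra.
have hi : g a < g a / 2 by lra.
have [e1 e10 He1] := (near_itvP _ _).1 (cvgr_gt (g a) cg _ lo).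
have [e2 e20 He2] := (near_itvP _ _).1 (cvgr_lt (g a) cg _ hi).
have [e3 e30 He3] := (near_itvP _ _).1 dfg.
exists (Num.min e1 (Num.min e2 e3)); first by rewrite !lt_min e10 e20.
move=> x y; rewrite ltrBlDr -ltrBlDl !lt_min => /and3P[x1 x2 x3] xy.
rewrite -ltrBlDl !lt_min => /and3P[y1 y2 y3].
have dxy z : x <= z <= y -> is_derive (z : R) 1 f (g z).
  by move=> /andP[xz zy]; apply: He3; apply/andP; split; lra.
have [||z] := @MVT_segment R f g x y xy.
- move=> z; rewrite in_itv/= => /andP[xz zy].
  by apply: dxy; rewrite !ltW.
- apply: continuous_in_subspaceT => z; rewrite inE/= in_itv => /dxy[dz _].
  exact: derivable_continuous.
rewrite in_itv/= => /andP[xz zy] fE.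
have g1 : 2 * g a < g z by apply: He1; apply/andP; split; lra.
have g2 : g z < g a / 2 by apply: He2; apply/andP; split; lra.
have yx0 : 0 <= y - x by rewrite subr_ge0.
by apply/andP; split; nra.
Qed.

(* The constants [k1] and [k2] are the bi-Lipschitz constants of [Im], and [e0] is
   a common radius for all the local conditions. *)
Variables (Im Ip H K : R -> R) (a k1 k2 e0 : R).
Hypotheses (k1_gt0 : 0 < k1) (e0_gt0 : 0 < e0).
Let J y := a - e0 < y < a + e0.
Hypothesis Im_bilip : forall x y, a - e0 < x -> x <= y -> y < a + e0 ->
  k1 * (y - x) <= Im x - Im y <= k2 * (y - x).
Hypothesis Ip_decr : forall x y, a - e0 < x -> x < y -> y < a + e0 ->
  Ip y < Ip x.
Hypothesis ImH : forall y, J y -> Im (H y) = Ip y.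
Hypothesis KH : forall y, J y -> K (H y) = y.
Hypothesis H_cont : forall y, J y -> {for y, continuous H}.
Hypothesis Ha : H a = a.
Let I y := Ip y - Im y.

(** [H] increases because [Im] and [Ip] both decrease, and
    [I y = Im (H y) - Im y] is comparable to [y - H y]. The inverse is handled
    through [z = K y], found by the intermediate value theorem: with [H z = y] the
    same identity at [z] compares [- I z] with [y - z]. *)
Lemma slow_relation_local : exists2 r, 0 < r <= e0 & forall y, a < y < a + r ->
  [/\ H y = y -> I y = 0,
      a < H y,
      0 < I y -> H y < y /\ k1 * (y - H y) <= I y <= k2 * (y - H y),
      a < K y /\ H (K y) = y
    & I y < 0 ->
      K y < y /\ k1 * (y - K y) <= - I (K y) <= k2 * (y - K y)].
Proof.
have e0P := e0_gt0; have Ja : J a by rewrite /J; apply/andP; split; lra.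
have Im_decr x y : a - e0 < x -> x < y -> y < a + e0 -> Im y < Im x.
  move=> ax xy ya; have /andP[h _] := Im_bilip ax (ltW xy) ya.
  rewrite -subr_gt0; apply: lt_le_trans h.
  by rewrite mulr_gt0// subr_gt0.
have [e1 /[swap] e1J e10] : exists2 e1, 0 < e1 &
    forall y, a - e1 < y < a + e1 -> J y /\ J (H y).
  have cHa := H_cont Ja.
  have h1 : a - e0 < H a by rewrite Ha; lra.
  have h2 : H a < a + e0 by rewrite Ha; lra.
  have [d1 d10 D1] := (near_itvP _ _).1 (cvgr_gt (H a) cHa _ h1).
  have [d2 d20 D2] := (near_itvP _ _).1 (cvgr_lt (H a) cHa _ h2).
  exists (Num.min e0 (Num.min d1 d2)); first by rewrite !lt_min e0_gt0 d10.
  move=> y; rewrite ltrBlDr -ltrBlDl -[y < _]ltrBlDl !lt_min.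
  move=> /andP[/and3P[? ? ?] /and3P[? ? ?]]; split.
    by rewrite /J; apply/andP; split; lra.
  by apply/andP; split; [apply: D1|apply: D2]; apply/andP; split; lra.
have H_incr x y : a - e1 < x -> x < y -> y < a + e1 -> H x < H y.
  move=> ax xy ya.
  have [|Jx /andP[Hx1 Hx2]] := e1J x; first by apply/andP; split; lra.
  have [|Jy /andP[Hy1 Hy2]] := e1J y; first by apply/andP; split; lra.
  rewrite ltNge; apply/negP => HyHx.
  have [Hx0 Hx0'] := andP Jx; have [Hy0 Hy0'] := andP Jy.
  have : Ip y < Ip x by exact: Ip_decr.
  rewrite -ImH// -[Ip x]ImH// ltNge => /negP; apply.
  move: HyHx; rewrite le_eqVlt => /predU1P[->//|HyHx].
  by rewrite ltW//; apply: Im_decr.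
pose b := a + e1 / 2.
have ab : a < b by rewrite /b; lra.
have aHb : a < H b by rewrite -{1}Ha; apply: H_incr; rewrite /b; lra.
exists (Num.min (e1 / 2) (Num.min (H b - a) e0)).
  by rewrite !lt_min !ge_min lexx !orbT andbT subr_gt0 aHb e0_gt0; lra.
move=> y; rewrite -[y < _]ltrBlDl !lt_min => /andP[ay /and3P[y1 y2 y3]].
have [|Jy JHy] := e1J y; first by apply/andP; split; lra.
have [Hy0 Hy0'] := andP Jy; have [Hy1 Hy1'] := andP JHy.
have aHy : a < H y by rewrite -{1}Ha; apply: H_incr; lra.
have IE z : J z -> I z = Im (H z) - Im z by move=> Jz; rewrite /I ImH.
have I_lt0 z : J z -> J (H z) -> I z < 0 -> z < H z.
  move=> Jz /andP[h1 h2]; rewrite IE// subr_lt0 => lt.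
  rewrite ltNge; apply/negP; rewrite le_eqVlt => /predU1P[Hzz|Hzz].
    by move: lt; rewrite Hzz ltxx.
  have [z0 z0'] := andP Jz.
  by move: (lt_trans lt (Im_decr _ _ h1 Hzz z0')); rewrite ltxx.
have [z [az zb] Hzy] : exists2 z, a < z /\ z <= b & H z = y.
  have cH : {within `[a, b], continuous H}.
    apply: continuous_in_subspaceT => z; rewrite inE/= in_itv/= => /andP[az zb].
    apply: H_cont; have [|//] := e1J z.
    by move: zb; rewrite /b => ?; apply/andP; split; lra.
  have [|z] := @IVT R H a b y (ltW ab) cH.
    by rewrite Ha ge_min le_max (ltW ay)/=; apply/orP; right; lra.
  rewrite in_itv/= => /andP[az zb] Hzy; exists z => //; split=> //.
  rewrite lt_neqAle az andbT; apply/eqP => za.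
  by move: ay; rewrite -Hzy -za Ha ltxx.
have [|Jz JHz] := e1J z; first by move: zb; rewrite /b => ?; apply/andP; split; lra.
have [z0 z0'] := andP Jz.
have Kyz : K y = z by rewrite -Hzy KH.
split.
- by move=> Hyy; rewrite IE// Hyy subrr.
- exact: aHy.
- move=> Iy; have Hyy : H y < y.
    rewrite ltNge; apply/negP; rewrite le_eqVlt => /predU1P[yHy|yHy].
      by move: Iy; rewrite IE// -yHy subrr ltxx.
    by move: Iy; rewrite IE// subr_gt0 ltNge ltW//; apply: Im_decr.
  by split => //; rewrite IE//; apply: Im_bilip => //; exact: ltW.
- by rewrite Kyz.
- move=> Iy; rewrite Kyz.
  have zy : z < y.
    have yHy := I_lt0 _ Jy JHy Iy.
    rewrite ltNge; apply/negP; rewrite le_eqVlt => /predU1P[yz|yz].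
      by move: yHy; rewrite {2}yz Hzy ltxx.
    have : H y < H z by apply: H_incr => //; move: zb; rewrite /b => ?; lra.
    by rewrite Hzy; move=> /(lt_trans yHy); rewrite ltxx.
  by split => //; rewrite IE// Hzy opprB; apply: Im_bilip => //; exact: ltW.
Qed.
End SlowRelationDynamics.

Section Orbits.
Set Implicit Arguments.
Unset Strict Implicit.
Unset Printing Implicit Defensive.
Context {R : realType}.
Implicit Types (f h D : R -> R) (a b x y : R) (u : R^nat).

(** The limit of the sequence is a fixed point of [h], and the only possible one is
    [a]. The two shifts cover both the orbits of [h], with [i = 0] and [j = 1], and
    those of a one-sided inverse of [h], with [i = 1] and [j = 0]. *)
Lemma nonincreasing_cvg_fixpoint u h a b (i j : nat) :
  nonincreasing_seq u -> (forall l, a < u l) -> u 0%N < b ->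
  (forall y, a < y < b -> {for y, continuous h} /\ h y != y) ->
  (forall l, h (u (l + i)%N) = u (l + j)%N) -> u @ \oo --> a.
Proof.
move=> nu au ub hP hu; pose L := inf (range u).
have lbu : has_lbound (range u) by exists a => _ [l _ <-]; exact: ltW.
have uL : u @ \oo --> L by exact: nonincreasing_cvgn.
have aL : a <= L.
  by apply: lb_le_inf; [exists (u 0%N), 0%N|move=> _ [l _ <-]; exact: ltW].
have Lb : L < b by apply: le_lt_trans ub; apply: ge_inf => //; exists 0%N.
suff <- : L = a by [].
apply/eqP; rewrite eq_le aL andbT leNgt; apply/negP => aL'.
have [|hL /eqP] := hP L; [by rewrite aL'|apply].
have cvi : (fun l => u (l + i)%N) @ \oo --> L by rewrite (cvg_shiftn i u).
have cvj : (fun l => u (l + j)%N) @ \oo --> L by rewrite (cvg_shiftn j u).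
have cvh : (fun l => h (u (l + i)%N)) @ \oo --> h L.
  exact: (cvg_comp _ _ cvi hL).
rewrite (_ : (fun l => _) = (fun l => u (l + j)%N)) in cvh; last exact/funext.
exact: (cvg_unique _ cvh cvj).
Qed.

Lemma orbit_seqS f y l : orbit_seq f y l.+1 = f (orbit_seq f y l).
Proof. by []. Qed.

Lemma orbit_seq_itv f a b y0 : (forall y, a < y < b -> a < f y < y) ->
  a < y0 < b -> (forall l, a < orbit_seq f y0 l < b) /\
  nonincreasing_seq (orbit_seq f y0).
Proof.
move=> fP y0ab.
have itv l : a < orbit_seq f y0 l < b.
  elim: l => // l IH; rewrite orbit_seqS; case/andP: (fP _ IH) => -> /= lt.
  by case/andP: IH => _; exact: lt_trans.
split=> //; apply/nonincreasing_seqP => l; rewrite orbit_seqS.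
by case/andP: (fP _ (itv l)) => _ /ltW.
Qed.

Lemma forward_orbit f D a b k1 k2 y0 :
  (forall y, a < y < b -> [/\ {for y, continuous f}, a < f y < y
    & k1 * (y - f y) <= D y <= k2 * (y - f y)]) ->
  a < y0 < b -> let u := orbit_seq f y0 in
  [/\ nonincreasing_seq u, forall l, a < u l, u @ \oo --> a
    & forall l, k1 * (u l - u l.+1) <= D (u l) <= k2 * (u l - u l.+1)].
Proof.
move=> fP y0ab u.
have [|itv nu] := @orbit_seq_itv f a b y0 _ y0ab; first by move=> y /fP[].
have au l : a < u l by case/andP: (itv l).
split=> // [|l]; last by have [] := fP _ (itv l).
apply: (@nonincreasing_cvg_fixpoint u f a b 0 1) => //.
- by case/andP: y0ab.
- by move=> y /fP[cf /andP[_ fy] _]; rewrite (lt_eqF fy).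
- by move=> l; rewrite addn0 addn1.
Qed.

(** Continuity is asked of the left inverse [h] of [f] on the orbit rather than of
    [f]: the inverse of the slow relation function is only given pointwise. *)
Lemma backward_orbit f h D a b k1 k2 y0 :
  (forall y, a < y < b -> [/\ {for y, continuous h}, h y != y, h (f y) = y,
      a < f y < y & k1 * (y - f y) <= D (f y) <= k2 * (y - f y)]) ->
  a < y0 < b -> let u := orbit_seq f y0 in
  [/\ nonincreasing_seq u, forall l, a < u l, u @ \oo --> a
    & forall l, k1 * (u l - u l.+1) <= D (u l.+1) <= k2 * (u l - u l.+1)].
Proof.
move=> fP y0ab u.
have [|itv nu] := @orbit_seq_itv f a b y0 _ y0ab; first by move=> y /fP[].
have au l : a < u l by case/andP: (itv l).
split=> // [|l]; last by have [] := fP _ (itv l).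
apply: (@nonincreasing_cvg_fixpoint u h a b 1 0) => //.
- by case/andP: y0ab.
- by move=> y /fP[].
- by move=> l; rewrite addn0 addn1 /u orbit_seqS; have [] := fP _ (itv l).
Qed.

Lemma gt0_of_near_right_gt0 D a b : (forall y, a < y < b -> {for y, continuous D}) ->
  (forall y, a < y < b -> D y != 0) -> (\forall x \near a^'+, 0 < D x) ->
  forall y, a < y < b -> 0 < D y.
Proof.
move=> cD D0 /at_right_itvP[e e0 De] y /andP[ay yb].
rewrite ltNge; apply/negP => Dy.
pose x := Num.min y (a + e / 2).
have ax : a < x by rewrite lt_min ay ltrDl divr_gt0.
have xy : x <= y by rewrite ge_min lexx.
have Dx : 0 < D x.
  by apply: De; rewrite ax gt_min/=; apply/orP; right; lra.
have [||z] := @IVT R D x y 0 xy.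
- apply: continuous_in_subspaceT => z; rewrite inE/= in_itv/= => /andP[xz zy].
  by apply: cD; rewrite (lt_le_trans ax)//= (le_lt_trans zy).
- by rewrite ge_min Dy orbT le_max ltW.
rewrite in_itv/= => /andP[xz zy] Dz; have := D0 z.
by rewrite Dz eqxx (lt_le_trans ax)//= (le_lt_trans zy)// => /(_ isT).
Qed.
End Orbits.

(** * Box dimension of the orbits *)

Section DimensionFromMultiplicity.
Set Implicit Arguments.
Unset Strict Implicit.
Unset Printing Implicit Defensive.
Context {R : realType}.
Variables (I H K : R -> R) (a b k1 k2 : R).
Hypotheses (k1_gt0 : 0 < k1) (k2_gt0 : 0 < k2).
Hypothesis I_ndiff : forall n, ndiff n I a.
Hypothesis HI_cont : forall y, a < y < b ->
  {for y, continuous H} /\ {for y, continuous I}.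
Hypothesis HK : forall y, a < y < b ->
  [/\ H y = y -> I y = 0,
      a < H y,
      0 < I y -> H y < y /\ k1 * (y - H y) <= I y <= k2 * (y - H y),
      a < K y /\ H (K y) = y
    & I y < 0 ->
      K y < y /\ k1 * (y - K y) <= - I (K y) <= k2 * (y - K y)].
Hypothesis I_neq0 : forall y, a < y < b -> I y != 0.
Implicit Types (m k : nat) (c y : R).

Lemma forward_orbit_slow_relation y0 : (forall y, a < y < b -> 0 < I y) ->
  a < y0 < b -> let u := orbit_seq H y0 in
  [/\ nonincreasing_seq u, forall l, a < u l, u @ \oo --> a
    & forall l, k1 * (u l - u l.+1) <= I (u l) <= k2 * (u l - u l.+1)].
Proof.
move=> Ipos; apply: forward_orbit => y yab.
have [cH _] := HI_cont yab.
by have [_ -> /(_ (Ipos _ yab))[-> ->] _ _] := HK yab.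
Qed.

Lemma backward_orbit_slow_relation y0 : (forall y, a < y < b -> I y < 0) ->
  a < y0 < b -> let u := orbit_seq K y0 in
  [/\ nonincreasing_seq u, forall l, a < u l, u @ \oo --> a
    & forall l, k1 * (u l - u l.+1) <= - I (u l.+1) <= k2 * (u l - u l.+1)].
Proof.
move=> Ineg; apply: (@backward_orbit _ K H (fun y => - I y)) => y yab.
have [cH _] := HI_cont yab.
have [Hfix _ _ [-> ->] /(_ (Ineg _ yab))[-> ->]] := HK yab; split=> //.
by apply/eqP => /Hfix/eqP; rewrite (negbTE (I_neq0 yab)).
Qed.

Lemma derive1n_eq0_of_taylor_coef k : taylor_coef I a k = 0 -> derive1n k I a = 0.
Proof.
move=> /eqP; rewrite mulf_eq0 invr_eq0 pnatr_eq0 -[(_ == 0)%N]negbK -lt0n fact_gt0.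
by rewrite orbF => /eqP.
Qed.

(** Near [a] the function [I] is squeezed between two positive multiples of
    [(y - a) ^+ m], and it is positive on the whole interval since it has no zero
    there. *)
Lemma forward_box_dim m y0 : (0 < m)%N -> zero_multiplicity I a m ->
  0 < taylor_coef I a m -> a < y0 < b -> let u := orbit_seq H y0 in
  [/\ nonincreasing_seq u, u @ \oo --> a, has_box_dim (range u) (1 - m%:R^-1)
    & (1 < m)%N -> minkowski_nondegenerate (range u)].
Proof.
move=> m0 [I0 _]; have m_fact : 0 < m`!%:R :> R by rewrite ltr0n fact_gt0.
have {}I0 k : (k < m)%N -> derive1n k I a = 0.
  by move=> /I0; exact: derive1n_eq0_of_taylor_coef.
rewrite /taylor_coef pmulr_lgt0 ?invr_gt0//; set v := derive1n m I a => v0 y0ab.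
have lo : v / 2 < v by lra.
have hi : v < v * 2 by lra.
have low := taylor_lower_bound (@I_ndiff m.+1) I0 lo.
have up := taylor_upper_bound (@I_ndiff m.+1) I0 hi.
have c0 : 0 < v / 2 / m`!%:R by rewrite !divr_gt0.
have c'0 : 0 < v * 2 / m`!%:R by rewrite divr_gt0// mulr_gt0.
have Ipos : forall y, a < y < b -> 0 < I y.
  apply: gt0_of_near_right_gt0 => //; first by move=> y /HI_cont[].
  near=> x; have ax : 0 < x - a.
    by rewrite subr_gt0; near: x; exact: nbhs_right_gt.
  apply: (@lt_le_trans _ _ (v / 2 / m`!%:R * (x - a) ^+ m)).
    by rewrite mulr_gt0// exprn_gt0.
  by near: x; exact: low.
have [nu au ua gap] := forward_orbit_slow_relation Ipos y0ab.
by have [? ?] := box_dim_forward nu au ua k1_gt0 k2_gt0 gap m0 c0 c'0 low up.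
Unshelve. all: by end_near. Qed.

(** The same squeeze, applied to [- I] at the lower ends of the gaps. *)
Lemma backward_box_dim m y0 : (0 < m)%N -> zero_multiplicity I a m ->
  taylor_coef I a m < 0 -> a < y0 < b -> let u := orbit_seq K y0 in
  [/\ nonincreasing_seq u, u @ \oo --> a, has_box_dim (range u) (1 - m%:R^-1)
    & (1 < m)%N -> minkowski_nondegenerate (range u)].
Proof.
move=> m0 [I0 _]; have m_fact : 0 < m`!%:R :> R by rewrite ltr0n fact_gt0.
have {}I0 k : (k < m)%N -> derive1n k I a = 0.
  by move=> /I0; exact: derive1n_eq0_of_taylor_coef.
rewrite /taylor_coef pmulr_llt0 ?invr_gt0//; set v := derive1n m I a => v0 y0ab.
have lo : v * 2 < v by lra.
have hi : v < v / 2 by lra.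
have low : \forall x \near a^'+, - (v / 2) / m`!%:R * (x - a) ^+ m <= - I x.
  apply: filterS (taylor_upper_bound (@I_ndiff m.+1) I0 hi) => x.
  by rewrite !mulNr lerN2.
have up : \forall x \near a^'+, - I x <= - (v * 2) / m`!%:R * (x - a) ^+ m.
  apply: filterS (taylor_lower_bound (@I_ndiff m.+1) I0 lo) => x.
  by rewrite !mulNr lerN2.
have c0 : 0 < - (v / 2) / m`!%:R by rewrite divr_gt0//; lra.
have c'0 : 0 < - (v * 2) / m`!%:R by rewrite divr_gt0//; lra.
have Ineg : forall y, a < y < b -> 0 < - I y.
  apply: (@gt0_of_near_right_gt0 _ (fun y => - I y)).
  - by move=> y /HI_cont[_ cI]; exact: continuousN.
  - by move=> y /I_neq0; rewrite oppr_eq0.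
  near=> x; have ax : 0 < x - a.
    by rewrite subr_gt0; near: x; exact: nbhs_right_gt.
  apply: (@lt_le_trans _ _ (- (v / 2) / m`!%:R * (x - a) ^+ m)).
    by rewrite mulr_gt0// exprn_gt0.
  by near: x; exact: low.
have {}Ineg y : a < y < b -> I y < 0 by move=> /Ineg; rewrite oppr_gt0.
have [nu au ua gap] := backward_orbit_slow_relation Ineg y0ab.
by have [? ?] := box_dim_backward nu au ua k1_gt0 k2_gt0 gap m0 c0 c'0 low up.
Unshelve. all: by end_near. Qed.

Hypothesis I_flat : zero_multiplicity_infinite I a.

Lemma forward_flat_box_dim y0 : (forall y, a < y < b -> 0 < I y) ->
  a < y0 < b -> has_box_dim (range (orbit_seq H y0)) 1.
Proof.
move=> Ipos y0ab; have I0 k := derive1n_eq0_of_taylor_coef (I_flat k).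
have [nu au ua gap] := forward_orbit_slow_relation Ipos y0ab.
apply: (box_dim_forward_flat nu au ua k1_gt0 gap) => k c c0.
have k_fact : 0 < k`!%:R :> R by rewrite ltr0n fact_gt0.
have ck : derive1n k I a < c * k`!%:R by rewrite I0 mulr_gt0.
apply: filterS (taylor_upper_bound (@I_ndiff k.+1) (fun j _ => I0 j) ck) => x.
by rewrite mulfK// gt_eqF.
Qed.

Lemma backward_flat_box_dim y0 : (forall y, a < y < b -> I y < 0) ->
  a < y0 < b -> has_box_dim (range (orbit_seq K y0)) 1.
Proof.
move=> Ineg y0ab; have I0 k := derive1n_eq0_of_taylor_coef (I_flat k).
have [nu au ua gap] := backward_orbit_slow_relation Ineg y0ab.
apply: (@box_dim_backward_flat _ _ _ nu au ua (fun y => - I y) _ _ k1_gt0 gap) => k c c0.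
have k_fact : 0 < k`!%:R :> R by rewrite ltr0n fact_gt0.
have ck : - (c * k`!%:R) < derive1n k I a by rewrite I0 oppr_lt0 mulr_gt0.
apply: filterS (taylor_lower_bound (@I_ndiff k.+1) (fun j _ => I0 j) ck) => x.
by rewrite !mulNr mulfK ?gt_eqF// lerNl.
Qed.

End DimensionFromMultiplicity.

Lemma itv_center_le {R : realType} {a e e' x y : R} : e <= e' ->
  a - e < x -> y < a + e -> a - e' < x /\ y < a + e'.
Proof. by move=> ee ax ya; split; lra. Qed.

Theorem theorem3p3 (R : realType) (Fm Gm Fp Gp : R -> R)
    (smooth_Fm : smooth Fm) (smooth_Gm : smooth Gm)
    (smooth_Fp : smooth Fp) (smooth_Gp : smooth Gp)
    (Fm0 : Fm 0 = 0) (dFm0 : derive1 Fm 0 = 0) (Gm0 : Gm 0 = 0)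
    (Fp0 : Fp 0 = 0) (dFp0 : derive1 Fp 0 = 0) (Gp0 : Gp 0 = 0)
    (ddFm0 : 0 < derive1n 2 Fm 0) (ddFp0 : 0 < derive1n 2 Fp 0)
    (dGm0 : derive1 Gm 0 < 0) (dGp0 : derive1 Gp 0 < 0)
    (yhat : R) (yhat_gt0 : 0 < yhat)
    (alpha omega : R -> R)
    (smooth_alpha : smooth_near alpha yhat)
    (smooth_omega : smooth_near omega yhat)
    (alpha_lt0 : alpha yhat < 0) (omega_gt0 : 0 < omega yhat)
    (Fm_alpha : \forall y \near yhat, Fm (alpha y) = y)
    (Fp_omega : \forall y \near yhat, Fp (omega y) = y)
    (FGm : forall x : R, alpha yhat <= x < 0 -> derive1 Fm x < 0 /\ 0 < Gm x)
    (FGp : forall x : R, 0 < x <= omega yhat -> 0 < derive1 Fp x /\ Gp x < 0) :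
  let Im := slow_divergence Fm Gm alpha in
  let Ip := slow_divergence Fp Gp omega in
  let I := fun y => Ip y - Im y in
  forall (balanced : I yhat = 0)
    (H : R -> R) (H_slow : slow_relation Im Ip yhat H)
    (Hinv : R -> R) (HinvP : local_inverse H Hinv yhat),
  exists2 r : R, 0 < r & forall ystar : R, 0 < ystar < r ->
  (forall y : R, yhat < y < yhat + ystar -> I y != 0) ->
  (forall m : nat, (1 <= m)%N -> zero_multiplicity I yhat m ->
    exists2 d : R, m%:R = 1 / (1 - d) &
    forall y0 : R, yhat < y0 < yhat + ystar ->
    let claim (u : R^nat) :=
      [/\ nonincreasing_seq u, u @ \oo --> yhat, has_box_dim (range u) d
        & (1 < m)%N -> minkowski_nondegenerate (range u)] in
    (0 < taylor_coef I yhat m -> claim (orbit_seq H y0)) /\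
    (taylor_coef I yhat m < 0 -> claim (orbit_seq Hinv y0)))
  /\
  (zero_multiplicity_infinite I yhat ->
    forall y0 : R, yhat < y0 < yhat + ystar ->
    ((forall y : R, yhat < y < yhat + ystar -> 0 < I y) ->
      has_box_dim (range (orbit_seq H y0)) 1) /\
    ((forall y : R, yhat < y < yhat + ystar -> I y < 0) ->
      has_box_dim (range (orbit_seq Hinv y0)) 1)).
Proof.
move=> Im Ip I balanced H [sH Ha ImH] K HK.
have dGm0' : derive1 Gm 0 != 0 by rewrite lt_eqF.
have dGp0' : derive1 Gp 0 != 0 by rewrite lt_eqF.
have alpha_neq0 : alpha yhat != 0 by rewrite lt_eqF.
have omega_neq0 : omega yhat != 0 by rewrite gt_eqF.
have Gm_neq0 x : Num.min (alpha yhat) 0 <= x <= Num.max (alpha yhat) 0 ->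
    x != 0 -> Gm x != 0.
  rewrite (min_l (ltW alpha_lt0)) (max_r (ltW alpha_lt0)) => /andP[ax x0] xn0.
  by have [|_ /gt_eqF->] := FGm x; first by rewrite ax lt_neqAle xn0.
have Gp_neq0 x : Num.min (omega yhat) 0 <= x <= Num.max (omega yhat) 0 ->
    x != 0 -> Gp x != 0.
  rewrite (min_r (ltW omega_gt0)) (max_l (ltW omega_gt0)) => /andP[x0 xo] xn0.
  by have [|_ /lt_eqF->] := FGp x; first by rewrite lt_neqAle eq_sym xn0 x0.
have dIm := slow_divergence_derive smooth_Fm smooth_Gm dFm0 Gm0 dGm0'
  smooth_alpha Fm_alpha alpha_neq0 Gm_neq0.
have dIp := slow_divergence_derive smooth_Fp smooth_Gp dFp0 Gp0 dGp0'
  smooth_omega Fp_omega omega_neq0 Gp_neq0.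
pose gm y := derive1 Fm (alpha y) / Gm (alpha y).
pose gp y := derive1 Fp (omega y) / Gp (omega y).
have [Fm'a Gma] : derive1 Fm (alpha yhat) < 0 /\ 0 < Gm (alpha yhat).
  by apply: FGm; rewrite lexx.
have [Fp'o Gpo] : 0 < derive1 Fp (omega yhat) /\ Gp (omega yhat) < 0.
  by apply: FGp; rewrite lexx andbT.
have gm_lt0 : gm yhat < 0 by rewrite /gm pmulr_llt0 ?invr_gt0.
have gp_lt0 : gp yhat < 0 by rewrite /gp pmulr_rlt0 ?invr_lt0.
have ngm n : ndiff n gm yhat.
  by apply: ndiff_slow_divergence_derivative => //; rewrite gt_eqF.
have ngp n : ndiff n gp yhat.
  by apply: ndiff_slow_divergence_derivative => //; rewrite lt_eqF.
have ndiff_cont f : (forall n, ndiff n f yhat) -> {for yhat, continuous f}.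
  by move=> nf; exact: (derivable_continuous (nbhs_singleton (nf 1%N 0%N isT))).
have [k1 [k2 [k10 k20 [e1 e10 Im_bilip]]]] :=
  bilipschitz_of_derive_lt0 dIm (ndiff_cont _ ngm) gm_lt0.
have [q1 [q2 [q10 q20 [e2 e20 Ip_bilip]]]] :=
  bilipschitz_of_derive_lt0 dIp (ndiff_cont _ ngp) gp_lt0.
have nI n : ndiff n I yhat.
  apply: ndiffW; apply: ndiffD; first exact: (ndiff_of_is_derive dIp (ngp n)).
  by apply: ndiffN; exact: (ndiff_of_is_derive dIm (ngm n)).
have [e3 e30 He3] := (near_itvP _ _).1 (nI 1%N 0%N isT).
have [e4 e40 He4] := (near_itvP _ _).1 sH.
have [e5 e50 He5] := (near_itvP _ _).1 ImH.
have [e6 e60 He6] := (near_itvP _ _).1 HK.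
pose e := Num.min e1 (Num.min e2 (Num.min e3 (Num.min e4 (Num.min e5 e6)))).
have e0 : 0 < e by rewrite !lt_min e10 e20 e30 e40 e50.
have : [/\ e <= e1, e <= e2 & e <= e3] /\ [/\ e <= e4, e <= e5 & e <= e6].
  by rewrite /e !ge_min !lexx !orbT.
move=> [[le1 le2 le3] [le4 le5 le6]].
have near_e (P : R -> Prop) e' : e <= e' ->
    (forall y, yhat - e' < y < yhat + e' -> P y) ->
    forall y, yhat - e < y < yhat + e -> P y.
  move=> ee' P' y /andP[y1 y2]; apply: P'.
  by have [-> ->] := itv_center_le ee' y1 y2.
have Im_bilip' x y : yhat - e < x -> x <= y -> y < yhat + e ->
    k1 * (y - x) <= Im x - Im y <= k2 * (y - x).
  move=> ax xy ya; have [ax1 ya1] := itv_center_le le1 ax ya.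
  exact: Im_bilip ax1 xy ya1.
have Ip_decr x y : yhat - e < x -> x < y -> y < yhat + e -> Ip y < Ip x.
  move=> ax xy ya; rewrite -subr_gt0.
  have [ax2 ya2] := itv_center_le le2 ax ya.
  have /andP[+ _] := Ip_bilip _ _ ax2 (ltW xy) ya2.
  by apply: lt_le_trans; rewrite mulr_gt0// subr_gt0.
have ImH' := near_e _ _ le5 He5.
have KH' : forall y, yhat - e < y < yhat + e -> K (H y) = y.
  by apply: (near_e _ _ le6) => y /He6[].
have H_cont : forall y, yhat - e < y < yhat + e -> {for y, continuous H}.
  by apply: (near_e _ _ le4) => y /He4 /(_ 0%N); exact: derivable_continuous.
have I_cont : forall y, yhat - e < y < yhat + e -> {for y, continuous I}.
  by apply: (near_e _ _ le3) => y /He3; exact: derivable_continuous.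
have [r /andP[r0 re] loc] :=
  slow_relation_local k10 e0 Im_bilip' Ip_decr ImH' KH' H_cont Ha.
exists r => // ys /andP[ys0 ysr] I_neq0.
have J_sub y : yhat < y < yhat + ys -> yhat < y < yhat + r.
  by move=> /andP[-> yys]; rewrite (lt_trans yys)// ltrD2l.
have J_sub_e y : yhat < y < yhat + ys -> yhat - e < y < yhat + e.
  move=> /J_sub/andP[y1 y2]; rewrite (lt_le_trans y2) ?lerD2l// andbT.
  by rewrite (lt_trans _ y1)// ltrBlDr ltrDl.
have HI_cont y : yhat < y < yhat + ys ->
    {for y, continuous H} /\ {for y, continuous I}.
  by move=> /J_sub_e ye; split; [exact: H_cont|exact: I_cont].
have locJ y (yJ : yhat < y < yhat + ys) := loc y (J_sub y yJ).
split=> [m m1 mult|flat y0 y0J]; last first.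
  split=> sgn.
    exact: (forward_flat_box_dim k10 nI HI_cont locJ flat sgn y0J).
  exact: (backward_flat_box_dim k10 nI HI_cont locJ I_neq0 flat sgn y0J).
exists (1 - m%:R^-1).
  by rewrite opprB addrC subrK div1r invrK.
move=> y0 y0J; split=> coef.
  exact: (forward_box_dim k10 k20 nI HI_cont locJ I_neq0 m1 mult coef y0J).
exact: (backward_box_dim k10 k20 nI HI_cont locJ I_neq0 m1 mult coef y0J).
Qed.
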